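(* Let $R$ be a skew-invertible Hecke $R$-matrix of symmetry rank $p$, let $\mathcal{L}_q$ be the corresponding modified reflection equation algebra with generators $l_i^{\,j}$, and let $V$ be its fundamental module of $B$ type with basis $e_1,\dots,e_n$ and representation $\pi$ (all defined in the context). Then for every positive integer $k$ the tensor product $V^{\otimes k}$ is also an $\mathcal{L}_q$-module: a representation $\rho_k:\mathcal{L}_q\to \mathrm{End}(V^{\otimes k})$ is given in the basis $e_{i_1}\otimes\dots\otimes e_{i_k}$ by the matrices $$\rho_k^t(l_i^{\,j})=\pi^t(l_i^{\,j})\otimes I^{\otimes(k-1)}+\sum_{s=1}^{k-1}R^{-1}_{(s\to 1)}\Bigl[\pi^t(l_i^{\,j})\otimes I^{\otimes (k-1)}\Bigr]R^{-1}_{(1\to s)} .$$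
   Context: **Matrices.** Fix $n\ge 1$ and a nonzero $q\in\mathbb{C}$ with $q^k\ne 1$ for all $k\in\mathbb{N}$, $k\geq 1$. Put $\lambda=q-q^{-1}$, $k_q=(q^k-q^{-k})/(q-q^{-1})$. Lower indices of a matrix enumerate rows, upper indices columns. Subscripts of a matrix indicate the tensor factors in which it acts; $I$ is the unit matrix, $P$ the permutation (flip) matrix, $Tr_{(i)}$ the trace in the $i$-th factor. $R_i:=R_{i\,i+1}$. Chains: $R^{\pm1}_{(i\to j)}=R_i^{\pm1}R_{i+1}^{\pm1}\cdots R_j^{\pm1}$ if $i<j$, $R_i^{\pm1}R_{i-1}^{\pm1}\cdots R_j^{\pm1}$ if $i>j$, and $R_i^{\pm1}$ if $i=j$. **$R$-matrix.** $R$ is a complex $n^2\times n^2$ matrix with: (Yang–Baxter) $R_{12}R_{23}R_{12}=R_{23}R_{12}R_{23}$; (Hecke) $(R-qI)(R+q^{-1}I)=0$; (skew-invertibility) there is an $n^2\times n^2$ matrix $\Psi$ with $Tr_{(2)}R_{12}\Psi_{23}=P_{13}=Tr_{(2)}\Psi_{12}R_{23}$; (symmetry rank $p\in\mathbb{N}$) $A^{(p+1)}=0$ and $\mathrm{rank}\,A^{(p)}=1$, where the $q$-antisymmetrizers are $A^{(1)}=I$, $A^{(k)}_{12\dots k}=\frac{1}{k_q}A^{(k-1)}_{2\dots k}\bigl(q^{k-1}I-(k-1)_qR_{12}\bigr)A^{(k-1)}_{2\dots k}$. Put $B_1=Tr_{(2)}\Psi_{21}$. **Algebra.** The modified reflection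 equation algebra $\mathcal{L}_q$ is the unital associative $\mathbb{C}$-algebra generated by $l_i^{\,j}$, $1\le i,j\le n$, with relations, for $L=\|l_i^{\,j}\|$, $L_1=L\otimes I$, $$R_{12}L_1R_{12}L_1-L_1R_{12}L_1R_{12}=R_{12}L_1-L_1R_{12}.$$ **Fundamental module of $B$ type.** $V$ is an $n$-dimensional space with basis $e_i$ and the $\mathcal{L}_q$-action $\pi(l_i^{\,j})e_k=e_iB_k^{\,j}$. **Transposed matrices.** For an operator $\tau(x)$ on $V^{\otimes k}$, $\tau^t(x)$ denotes the transposed matrix, i.e. $\tau(x)e_I=\sum_J(\tau^t(x))_I^{\,J}e_J$ for the basis $e_I=e_{i_1}\otimes\dots\otimes e_{i_k}$ (so the matrix of a composition $\tau(x)\tau(y)$ is $\tau^t(y)\tau^t(x)$). *)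

(* Defs.v *)
From HB Require Import structures.
From mathcomp Require Import all_boot all_order all_algebra.
From mathcomp Require Import finmap boolp.
From mathcomp.multinomials Require Import monalg.

Set Implicit Arguments.
Unset Strict Implicit.
Unset Printing Implicit Defensive.

Import GRing.Theory.
Local Open Scope ring_scope.
Local Open Scope quotient_scope.

(** * Matrices acting in tensor powers *)

(* Multi-indices I = (i_1, ..., i_k) with entries in {1, ..., n}. *)
Notation mindex n k := {ffun 'I_k -> 'I_n}.

(* The n^k x n^k matrices; rows and columns are addressed by multi-indices
   through [ent], row (lower) index first. *)
Notation tmx A n k := 'M[A]_#|mindex n k|.

Definition of_ent (A : Type) (T : finType) (f : T -> T -> A) : 'M[A]_#|T| :=
  \matrix_(a, b) f (enum_val a) (enum_val b).

Definition ent (A : Type) (T : finType) (X : 'M[A]_#|T|) (I J : T) : A :=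
  X (enum_rank I) (enum_rank J).

(* An n x n matrix as a matrix on one tensor factor, and back. *)
Definition one_factor (A : Type) n (X : 'M[A]_n) : tmx A n 1 :=
  of_ent (fun I J : mindex n 1 => X (I ord0) (J ord0)).

Definition of_one_factor (A : Type) n (X : tmx A n 1) : 'M[A]_n :=
  \matrix_(i, j) ent X [ffun=> i] [ffun=> j].

(* [leg k s X], with s = [:: s_1; ...; s_m], is X_{s_1 ... s_m} on k.+1 tensor
   factors: the a-th factor of X is put in position s_a, and the other factors
   carry the identity.  Positions are counted from 1 and lie in 1, ..., k.+1. *)
Definition leg (A : pzRingType) n k m (s : seq nat) (X : tmx A n m) :
    tmx A n k.+1 :=
  of_ent (fun I J : mindex n k.+1 =>
    let at_s (K : mindex n k.+1) : mindex n m :=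
      [ffun a : 'I_m => K (inord (nth 0%N s a).-1)] in
    if [forall l : 'I_k.+1, (l.+1 \in s) || (I l == J l)]
    then ent X (at_s I) (at_s J) else 0).
Arguments leg {A n} k {m} s X.

Definition mindex_insert n k (i : 'I_k.+1) (a : 'I_n) (I : mindex n k) :
    mindex n k.+1 :=
  [ffun l => if unlift i l is Some l' then I l' else a].

(* Tr_(i), i counted from 1; the result is a matrix on the remaining factors,
   in their original order. *)
Definition ptrace (A : pzRingType) n k (i : nat) (X : tmx A n k.+1) :
    tmx A n k :=
  of_ent (fun I J : mindex n k =>
    let at_i := mindex_insert (inord i.-1) in
    \sum_(a < n) ent X (at_i a I) (at_i a J)).

Definition flip_mx (A : pzRingType) n : tmx A n 2 :=
  of_ent (fun I J : mindex n 2 =>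
    ((I ord0 == J ord_max) && (I ord_max == J ord0))%:R).
Arguments flip_mx {A n}.

(** * Hecke R-matrices *)

Section HeckeRMatrix.
Variables (F : fieldType) (n : nat) (q : F).
Implicit Types (R Psi : tmx F n 2) (p k : nat).

Definition qnum k : F := (q ^+ k - q ^- k) / (q - q^-1).

Definition yang_baxter R : Prop :=
  let R12 := leg 2 [:: 1; 2]%N R in let R23 := leg 2 [:: 2; 3]%N R in
  R12 *m R23 *m R12 = R23 *m R12 *m R23.

Definition hecke R : Prop := (R - q%:M) *m (R + (q^-1)%:M) = 0.

(* Both traces leave the factors 1 and 3, so that P_{13} is the flip of the two
   remaining factors. *)
Definition skew_inverse R Psi : Prop :=
  ptrace 2 (leg 2 [:: 1; 2]%N R *m leg 2 [:: 2; 3]%N Psi) = flip_mx /\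
  flip_mx = ptrace 2 (leg 2 [:: 1; 2]%N Psi *m leg 2 [:: 2; 3]%N R).

(* A^(k); the value for k = 0 is a convention which is never used. *)
Fixpoint antisym R k : tmx F n k :=
  match k return tmx F n k with
  | 0 => 1%:M
  | k1.+1 =>
    match k1 return tmx F n k1 -> tmx F n k1.+1 with
    | 0 => fun=> 1%:M
    | k2.+1 => fun A : tmx F n k2.+1 =>
      let A' := leg k2.+1 (iota 2 k2.+1) A in
      (qnum k2.+2)^-1 *:
        (A' *m ((q ^+ k2.+1)%:M - qnum k2.+1 *: leg k2.+1 [:: 1; 2]%N R) *m A')
    end (antisym R k1)
  end.

Definition symmetry_rank R p : Prop :=
  [/\ (0 < p)%N, antisym R p.+1 = 0 & \rank (antisym R p) = 1].

(* The matrix ||B_i^j||, where B_1 = Tr_(2) Psi_21. *)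
Definition Bmx Psi : 'M[F]_n :=
  of_one_factor (ptrace 2 (leg 1 [:: 2; 1]%N Psi)).

(* R_i^-1 on k.+1 factors, 1 <= i <= k, and the chain R^-1_(i -> j). *)
Definition Rinv k R (i : nat) : tmx F n k.+1 := invmx (leg k [:: i; i.+1] R).

Definition Rinv_chain k R (i j : nat) : tmx F n k.+1 :=
  if (i <= j)%N then \prod_(i <= l < j.+1) Rinv k R l
  else \prod_(l <- rev (index_iota j i.+1)) Rinv k R l.

End HeckeRMatrix.

(** * The modified reflection equation algebra *)

(* R_12 L_1 R_12 L_1 - L_1 R_12 L_1 R_12 - (R_12 L_1 - L_1 R_12) *)
Definition reflection_eq (F : fieldType) n (R : tmx F n 2) (A : lalgType F)
    (L : 'M[A]_n) : tmx A n 2 :=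
  let R12 := map_mx (in_alg A) R in
  let L1 := leg 1 [:: 1]%N (one_factor L) in
  R12 *m L1 *m R12 *m L1 - L1 *m R12 *m L1 *m R12 - (R12 *m L1 - L1 *m R12).

(* The two-sided ideal generated by S. *)
Inductive ideal_gen (A : pzRingType) (S : A -> Prop) : A -> Prop :=
| IdealGen0 : ideal_gen S 0
| IdealGenD u a x b : ideal_gen S u -> S x -> ideal_gen S (u + a * x * b).

Section IdealTheory.
Variables (A : pzRingType) (S : A -> Prop).
Implicit Types x y : A.

Lemma ideal_gen_add x y : ideal_gen S x -> ideal_gen S y -> ideal_gen S (x + y).
Proof.
by move=> Ix; elim=> [|u a z b _ IH Sz]; rewrite ?addr0 ?addrA //; constructor.
Qed.

Lemma ideal_gen_mul a x b : ideal_gen S x -> ideal_gen S (a * x * b).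
Proof.
elim=> [|u c z d _ IH Sz]; first by rewrite mulr0 mul0r; constructor.
have -> : a * (u + c * z * d) * b = a * u * b + (a * c) * z * (d * b).
  by rewrite mulrDr mulrDl !mulrA.
exact: IdealGenD.
Qed.

Lemma ideal_genB x y : ideal_gen S x -> ideal_gen S y -> ideal_gen S (x - y).
Proof.
move=> Ix /(ideal_gen_mul (-1) 1) Iy; rewrite -[- y]mulN1r -[_ * y]mulr1.
exact: ideal_gen_add.
Qed.

Lemma ideal_genM x x' y y' : ideal_gen S (x - x') -> ideal_gen S (y - y') ->
  ideal_gen S (x * y - x' * y').
Proof.
move=> /(ideal_gen_mul 1 y) Ix /(ideal_gen_mul x' 1) Iy.
have -> : x * y - x' * y' = 1 * (x - x') * y + x' * (y - y') * 1.
  by rewrite mul1r mulr1 mulrBl mulrBr addrA subrK.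
exact: ideal_gen_add.
Qed.

Lemma ideal_gen_rmorph0 (B : pzRingType) (f : {rmorphism A -> B}) x :
  (forall y, S y -> f y = 0) -> ideal_gen S x -> f x = 0.
Proof.
move=> Sf; elim=> [|u a z b _ IH Sz]; first exact: rmorph0.
by rewrite rmorphD !rmorphM /= (Sf _ Sz) mulr0 mul0r addr0.
Qed.

End IdealTheory.

Lemma ideal_genZ (F : fieldType) (A : lalgType F) (S : A -> Prop) c x x' :
  ideal_gen S (x - x') -> ideal_gen S (c *: x - c *: x').
Proof.
move=> /(ideal_gen_mul (c%:A) 1).
by rewrite mulr1 -scalerAl mul1r scalerBr.
Qed.

Lemma reflection_eq_map0 (F : fieldType) n (R : tmx F n 2) (A : lalgType F)
    (L : 'M[A]_n) (B : pzRingType) (f : {rmorphism A -> B}) I J :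
  (forall i j, f (L i j) = 0) -> f (ent (reflection_eq R L) I J) = 0.
Proof.
move=> fL0; suff E : map_mx f (reflection_eq R L) = 0.
  by have /matrixP/(_ (enum_rank I) (enum_rank J)) := E; rewrite [LHS]mxE [RHS]mxE.
have L0 : map_mx f (leg 1 [:: 1]%N (one_factor L)) = 0.
  apply/matrixP=> a b; rewrite 3!mxE /=; case: ifP => _; last exact: rmorph0.
  by rewrite /ent mxE fL0.
by rewrite /reflection_eq !(map_mxB, map_mxM) /= L0 !(mulmx0, mul0mx) !subr0.
Qed.

(* Free associative algebra on the l_i^j. *)
Notation free_alg F n := {malg F[{fmonom ('I_n * 'I_n)%type}]}.

Definition free_gen (F : fieldType) n : 'M[free_alg F n]_n :=
  \matrix_(i, j) << fmu (i, j) >>.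

Definition mrea_rel (F : fieldType) n (R : tmx F n 2) (x : free_alg F n) :
    Prop :=
  exists I J, x = ent (reflection_eq R (free_gen F n)) I J.

Section ReflectionAlgebra.
Variables (F : fieldType) (n : nat) (R : tmx F n 2).

Local Notation free := (free_alg F n).
Local Notation free_gen := (free_gen F n).
Local Notation rel := (mrea_rel R).

Definition mrea_ideal : {pred free} := fun x => `[< ideal_gen rel x >].

Lemma mrea_idealP x : reflect (ideal_gen rel x) (x \in mrea_ideal).
Proof. exact: asboolP. Qed.

Lemma mrea_ideal_zmod : zmod_closed mrea_ideal.
Proof.
split=> [|x y /mrea_idealP Ix /mrea_idealP Iy]; apply/mrea_idealP.
  exact: IdealGen0.
exact: ideal_genB.
Qed.

HB.instance Definition _ :=
  GRing.isZmodClosed.Build free mrea_ideal mrea_ideal_zmod.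

Lemma mrea_ideal_const x : x \in mrea_ideal -> x@_mone = 0.
Proof.
move=> /mrea_idealP; apply: (ideal_gen_rmorph0 (f := mcoeff mone)) => y [I [J ->]].
apply: reflection_eq_map0 => i j; rewrite mxE /= mcoeffU.
by case: eqP => // /(congr1 (@fmonom_val _)); rewrite fm1 fmU.
Qed.

Definition mrea : Type := Quotient.quot mrea_ideal.

HB.instance Definition _ : EqQuotient free (Quotient.equiv mrea_ideal) mrea :=
  EqQuotient.on mrea.
HB.instance Definition _ := Choice.on mrea.
HB.instance Definition _ := GRing.Zmodule.on mrea.

Let mrea_eqP (x y : free) : (x == y %[mod mrea]) = (x - y \in mrea_ideal).
Proof. by rewrite piE. Qed.

Let mrea_reprP (x : free) : ideal_gen rel (x - repr (\pi_mrea x)).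
Proof. by apply/mrea_idealP; rewrite -mrea_eqP reprK. Qed.

Let one : mrea := \pi_mrea 1.
Let mul (x y : mrea) : mrea := \pi_mrea (repr x * repr y).
Let scale (c : F) (x : mrea) : mrea := \pi_mrea (c *: repr x).

Let piD (x y : free) : \pi_mrea (x + y) = \pi_mrea x + \pi_mrea y :> mrea.
Proof. by rewrite piE. Qed.

Let piM (x y : free) : mul (\pi_mrea x) (\pi_mrea y) = \pi_mrea (x * y).
Proof.
by apply/esym/eqP; rewrite mrea_eqP; apply/mrea_idealP/ideal_genM.
Qed.

Let piZ c (x : free) : scale c (\pi_mrea x) = \pi_mrea (c *: x).
Proof.
by apply/esym/eqP; rewrite mrea_eqP; apply/mrea_idealP/ideal_genZ.
Qed.

Let mrea_ind (P : mrea -> Prop) : (forall x, P (\pi_mrea x)) -> forall x, P x.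
Proof. by move=> H x; rewrite -[x]reprK. Qed.

Let mulA : associative mul.
Proof.
by elim/mrea_ind=> x; elim/mrea_ind=> y; elim/mrea_ind=> z; rewrite !piM mulrA.
Qed.
Let mul1 : left_id one mul.
Proof. by elim/mrea_ind=> x; rewrite piM mul1r. Qed.
Let mulr_1 : right_id one mul.
Proof. by elim/mrea_ind=> x; rewrite piM mulr1. Qed.
Let mulDl : left_distributive mul +%R.
Proof.
elim/mrea_ind=> x; elim/mrea_ind=> y; elim/mrea_ind=> z.
by rewrite -piD !piM -piD mulrDl.
Qed.
Let mulDr : right_distributive mul +%R.
Proof.
elim/mrea_ind=> x; elim/mrea_ind=> y; elim/mrea_ind=> z.
by rewrite -piD !piM -piD mulrDr.
Qed.
Let one_neq0 : one != 0.
Proof.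
apply/negP; have -> : 0 = \pi_mrea 0 :> mrea by rewrite piE.
rewrite mrea_eqP subr0 => /mrea_ideal_const; rewrite mcoeff1 eqxx.
by apply/eqP/oner_neq0.
Qed.

HB.instance Definition _ :=
  GRing.Zmodule_isNzRing.Build mrea mulA mul1 mulr_1 mulDl mulDr one_neq0.

Let scaleA a b x : scale a (scale b x) = scale (a * b) x.
Proof. by elim/mrea_ind: x => x; rewrite !piZ scalerA. Qed.
Let scale1 : left_id 1 scale.
Proof. by elim/mrea_ind=> x; rewrite piZ scale1r. Qed.
Let scaleDr : right_distributive scale +%R.
Proof.
by move=> a; elim/mrea_ind=> x; elim/mrea_ind=> y; rewrite -piD !piZ -piD scalerDr.
Qed.
Let scaleDl x : {morph scale^~ x : a b / a + b}.
Proof. by move=> a b; elim/mrea_ind: x => x; rewrite !piZ -piD scalerDl. Qed.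

HB.instance Definition _ :=
  GRing.Zmodule_isLmodule.Build F mrea scaleA scale1 scaleDr scaleDl.

Let scaleAl a (x y : mrea) : a *: (x * y) = a *: x * y.
Proof.
elim/mrea_ind: x => x; elim/mrea_ind: y => y.
by rewrite -[LHS]/(scale a (mul _ _)) -[RHS]/(mul (scale _ _) _) !(piM, piZ) scalerAl.
Qed.

HB.instance Definition _ := GRing.Lmodule_isLalgebra.Build F mrea scaleAl.

Let free_scaleAr a (x y : free) : a *: (x * y) = x * (a *: y).
Proof.
apply/malgP=> k; rewrite mcoeffZ (mcoeffMlw k (fsubset_refl _) (msuppZ_le a y)).
rewrite mcoeffMl mulr_sumr; apply: eq_bigr => k1 _.
rewrite mulr_sumr; apply: eq_bigr => k2 _.
by rewrite mcoeffZ mulrnAr mulrCA.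
Qed.

Let scaleAr a (x y : mrea) : a *: (x * y) = x * (a *: y).
Proof.
elim/mrea_ind: x => x; elim/mrea_ind: y => y.
rewrite -[LHS]/(scale a (mul _ _)) -[RHS]/(mul _ (scale _ _)) !(piM, piZ).
by rewrite free_scaleAr.
Qed.

HB.instance Definition _ := GRing.Lalgebra_isAlgebra.Build F mrea scaleAr.

(* The generator l_i^j. *)
Definition mrea_gen (i j : 'I_n) : mrea := \pi_mrea (free_gen i j).

End ReflectionAlgebra.

(** * Modules *)

Section Modules.
Variable F : fieldType.

Definition is_representation (A : algType F) (V : vectType F)
    (rho : A -> 'End(V)) : Prop :=
  [/\ linear rho, rho 1 = \1%VF
    & forall x y, rho (x * y) = (rho x \o rho y)%VF].

(* The space with basis (e_x), x in T: V is the case T = 'I_n, with basis e_i,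
   and its tensor power V^{(x)k} is the case T = mindex n k, with basis
   e_I = e_{i_1} (x) ... (x) e_{i_k}. *)
Definition coord_space (T : finType) : vectType F := {ffun T -> F^o}.

Definition basis_vect (T : finType) (x : T) : coord_space T :=
  [ffun y => (x == y)%:R].

(* (tau^t)_x^y, the coefficient of e_y in tau e_x. *)
Definition tr_ent (T : finType) (tau : 'End(coord_space T)) (x y : T) : F :=
  tau (basis_vect x) y.

(* The fundamental module of B type. *)
Definition fundamental_B (n : nat) (R Psi : tmx F n 2)
    (pi : mrea R -> 'End(coord_space 'I_n)) : Prop :=
  is_representation pi /\
  forall i j k, pi (mrea_gen R i j) (basis_vect k) =
                Bmx Psi k j *: basis_vect i.

End Modules.
Arguments coord_space F T : clear implicits.

(* Main.v *)
Require Import Defs.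
From HB Require Import structures.
From mathcomp Require Import all_boot all_order all_algebra.
From mathcomp Require Import finmap zify ring.
From mathcomp.multinomials Require Import monalg.
From mathcomp Require Import reals complex.

Set Implicit Arguments.
Unset Strict Implicit.
Unset Printing Implicit Defensive.

Import GRing.Theory.
Local Open Scope ring_scope.

(** Write y_i for the inverse of R_i, D_s = y_s ... y_1, U_s = y_1 ... y_s,
    and lambda = q - q^-1, so that y_i^2 = 1 - lambda y_i. Transposition
    reverses products, so the matrices T_i^j = sum_s D_s M_i^j U_s have to
    satisfy the reflection equation with all products of entries reversed;
    here M_i^j, the matrix of a generator on the first factor, is the rank
    one matrix with entries B_a^j delta_i^b.

    The two terms of the reflection equation that are quadratic in T are one
    and the same tensor X_ab^ef = sum_cd R_cb^df T_d^e T_a^c, multiplied by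
    R on the left and on the right, and the two linear terms are likewise
    T_a^e delta_b^f multiplied by R on the left and on the right. So the
    equation says that X - T delta commutes with R. Expanding T, one meets
    contractions of R with M_d^e U_s D_t M_a^c. The braid and Hecke
    relations reduce U_s D_t to words in which y_1 occurs at most once; the
    other letters act away from the first factor and commute with M. Two
    contractions remain:

      sum_cd R_cb^df M_d^e M_a^c = delta_b^f M_a^e,
      sum_cd R_cb^df M_d^e y_1 M_a^c = G_ab^ef,

    where G_ab^ef is M_a^e on the first factor times M_b^f on the second
    ([fuse1_mx], [fuse_S_mx]). The first one is Tr_(1) B_1 R_12 = 1. The
    second one comes from R_12 R_23 R_12^-1 = R_23^-1 R_12 R_23: the
    B-weighted trace over factor 1 of the right side is the identity, so the
    same trace of the left side exhibits a skew-inverse of R, and a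
    skew-inverse is unique ([skewB_exchange]).

    With y = y_1, regrouping the terms by the braid relations gives

      X - T delta = sum_(j < s) E (G y + y G - lambda y G y) E',

    where E and E' are words in the y_i ([fuse_tensor]). Multiplying the
    indices of G by R on the left amounts to multiplying the matrix G on the
    right by R_1, while multiplying the indices on the right amounts to
    multiplying the matrix on the left by R_1; the latter uses that B_1 B_2
    commutes with R ([skewB_comm]). As R_1 = y + lambda is inverse to y,
    both turn the bracket into G + y G y ([cross_term_comm]), whence the
    reflection equation ([tensor_act_reflection]). The representation then
    exists by the universal property of the algebra ([mrea_lift]). *)

(** * Braid group chains *)

Section Chains.
Variables (A : pzRingType) (y : nat -> A).

(** Chains on the generators m+1, ..., m+s. The chains that avoid the first
    generator are those with m = 1; all the rewriting below trades chains
    with m = 0 against chains with m = 1. *)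
Fixpoint dchain m s : A := if s is s1.+1 then y (m + s) * dchain m s1 else 1.
Fixpoint uchain m s : A := if s is s1.+1 then uchain m s1 * y (m + s) else 1.

Lemma dchain_recr m s : dchain m s.+1 = dchain m.+1 s * y m.+1.
Proof.
elim: s => [|s IH]; first by rewrite /= mulr1 mul1r addn1.
by rewrite [LHS]/= -/(dchain m s.+1) IH /= mulrA addnS addSn.
Qed.

Lemma dchain_rev m s :
  dchain m s = \prod_(l <- rev (index_iota m.+1 (m + s).+1)) y l.
Proof.
elim: s => [|s IH]; first by rewrite addn0 /index_iota subnn big_nil.
rewrite [LHS]/= IH /index_iota !subSS addKn addnS subSn ?leq_addr // addKn.
by rewrite -[s.+1]addn1 iotaD rev_cat big_cat big_seq1 addSn.
Qed.

Lemma uchain_iota m s : uchain m s = \prod_(m.+1 <= l < (m + s).+1) y l.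
Proof.
elim: s => [|s IH]; first by rewrite addn0 big_geq.
by rewrite /= IH !addnS [RHS]big_nat_recr //= ltnS leq_addr.
Qed.

Variable k : nat.
Hypothesis y_braid : forall i, (0 < i < k)%N ->
  y i * y i.+1 * y i = y i.+1 * y i * y i.+1.
Hypothesis y_far : forall i j, (0 < i)%N -> (i.+1 < j <= k)%N ->
  y i * y j = y j * y i.

(** Coming from the left, y_i commutes with all letters until it meets
    y_(i+1) y_i; one braid relation turns it into y_(i+1), which commutes
    with the letters that remain. *)
Lemma braid_dchain i r : (0 < i < r)%N -> (r <= k)%N ->
  y i * dchain 0 r = dchain 0 r * y i.+1.
Proof.
elim: r => [|r IH]; first by rewrite ltn0 andbF.
move=> /andP[i0]; rewrite ltnS leq_eqVlt => /orP[/eqP<-{r IH}|ir] rk.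
  case: i i0 rk => // i _ ik; rewrite /= !add0n.
  rewrite !mulrA y_braid ?ik //.
  suff C j : (j <= i)%N -> dchain 0 j * y i.+2 = y i.+2 * dchain 0 j.
    by rewrite -!mulrA C.
  elim: j => [|j IH] ji; first by rewrite mulr1 mul1r.
  by rewrite /= add0n -mulrA IH ?(ltnW ji) // !mulrA y_far // ltnS; apply/andP.
rewrite /= !add0n mulrA y_far //; last by rewrite ltnS ir.
by rewrite -!mulrA IH ?i0 // ltnW.
Qed.

(** Pushing y_1, ..., y_s one after the other through y_(r+1) ... y_1 shifts
    them to y_2, ..., y_(s+1) and leaves a single y_1 in the word. *)
Lemma uchain_dchain s r : (s <= r)%N -> (r.+1 <= k)%N ->
  uchain 0 s * dchain 0 r.+1 = dchain 1 r * y 1 * uchain 1 s.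
Proof.
move=> sr rk; rewrite -dchain_recr; elim: s sr => [|s IH] sr.
  by rewrite mulr1 mul1r.
by rewrite [uchain 0 _]/= -mulrA add0n braid_dchain // mulrA IH ?(ltnW sr) //
  -mulrA.
Qed.

Lemma dchain_dchain s r : (s <= r)%N -> (r.+1 <= k)%N ->
  dchain 0 r.+1 * dchain 1 s = dchain 0 s * dchain 1 r * y 1.
Proof.
move=> sr rk; rewrite -mulrA -dchain_recr; elim: s sr => [|s IH] sr.
  by rewrite mulr1 mul1r.
by rewrite [dchain 1 _]/= mulrA add1n -braid_dchain // -mulrA IH ?(ltnW sr) //
  /= -mulrA add0n.
Qed.

End Chains.

(** Reversing words exchanges the two kinds of chains, so each identity has
    a mirror image, obtained for free in the converse ring. *)
Lemma dchain_conv (A : pzRingType) (y : nat -> A) m s :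
  dchain (y : nat -> A^c) m s = uchain y m s.
Proof. by elim: s => //= s ->. Qed.

Lemma uchain_conv (A : pzRingType) (y : nat -> A) m s :
  uchain (y : nat -> A^c) m s = dchain y m s.
Proof. by elim: s => //= s ->. Qed.

Section ChainsOpp.
Variables (A : pzRingType) (y : nat -> A).
Variable k : nat.
Hypothesis y_braid : forall i, (0 < i < k)%N ->
  y i * y i.+1 * y i = y i.+1 * y i * y i.+1.
Hypothesis y_far : forall i j, (0 < i)%N -> (i.+1 < j <= k)%N ->
  y i * y j = y j * y i.

Let y_braidc i : (0 < i < k)%N ->
  (y i : A^c) * y i.+1 * y i = (y i.+1 : A^c) * y i * y i.+1.
Proof. by move=> /y_braid E; rewrite -mulrA -[RHS]mulrA in E; exact: E. Qed.
Let y_farc i j : (0 < i)%N -> (i.+1 < j <= k)%N ->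
  (y i : A^c) * y j = (y j : A^c) * y i.
Proof. by move=> i0 ij; exact: esym (y_far i0 ij). Qed.

Lemma uchain_dchain_ge s r : (r <= s)%N -> (s.+1 <= k)%N ->
  uchain y 0 s.+1 * dchain y 0 r = dchain y 1 r * y 1 * uchain y 1 s.
Proof.
move=> rs sk; have := uchain_dchain y_braidc y_farc rs sk.
by rewrite !uchain_conv !dchain_conv -[RHS]mulrA.
Qed.

Lemma uchain_uchain s r : (s <= r)%N -> (r.+1 <= k)%N ->
  uchain y 1 s * uchain y 0 r.+1 = y 1 * uchain y 1 r * uchain y 0 s.
Proof.
move=> sr rk; have := dchain_dchain y_braidc y_farc sr rk.
by rewrite !dchain_conv -[RHS]mulrA.
Qed.
End ChainsOpp.

Lemma sum_square_diag (V : zmodType) (f : nat -> nat -> V) N :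
  \sum_(0 <= s < N) \sum_(0 <= t < N) f s t =
  \sum_(0 <= s < N) (f s s + \sum_(0 <= j < s) (f j s + f s j)).
Proof.
elim: N => [|N IH]; first by rewrite !big_geq.
rewrite !big_nat_recr //= -IH.
under eq_bigr => s _ do rewrite big_nat_recr //=.
rewrite !big_split /= -!addrA; congr (_ + _).
by rewrite addrA addrC.
Qed.

(** * The reflection equation for tensor products, abstractly *)

(** The algebra A plays the role of the endomorphisms of a tensor power: m
    is a generator acting on the first factor, y is the braid action, and G
    is the simultaneous action of two generators on the first two factors. *)
Section Fusion.
Variables (F : fieldType) (A : algType F) (I : finType)
  (r : I -> I -> I -> I -> F).
Variables (lam : F) (k : nat) (y : nat -> A) (m : I -> I -> A).
Variable G : I -> I -> I -> I -> A.
Hypothesis y_braid : forall i, (0 < i < k)%N ->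
  y i * y i.+1 * y i = y i.+1 * y i * y i.+1.
Hypothesis y_far : forall i j, (0 < i)%N -> (i.+1 < j <= k)%N ->
  y i * y j = y j * y i.
Hypothesis y_quad : forall i, (0 < i <= k)%N -> y i * y i = 1 - lam *: y i.
Hypothesis m_y : forall i a b, (1 < i <= k)%N -> GRing.comm (m a b) (y i).

(** The contraction of R_12 L_1 R_12 L_1 that survives once the outer R_12
    is removed, with X inserted between the two generators; the order of the
    two generators is the reversed one. *)
Definition fuse (X : A) a b e f : A :=
  \sum_(c : I) \sum_(d : I) r c b d f *: (m d e * X * m a c).

Hypothesis fuse1 : forall a b e f, fuse 1 a b e f = (b == f)%:R *: m a e.
Hypothesis fuse_y : (0 < k)%N -> forall a b e f, fuse (y 1) a b e f = G a b e f.
Hypothesis rG : (0 < k)%N -> forall i j e f,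
  \sum_a \sum_b r i j a b *: G a b e f = G i j e f * (y 1 + lam%:A).
Hypothesis Gr : (0 < k)%N -> forall i j e f,
  \sum_a \sum_b r a b e f *: G i j a b = (y 1 + lam%:A) * G i j e f.

Local Notation D := (dchain y).
Local Notation U := (uchain y).

Definition tensor_act a b : A := \sum_(0 <= s < k.+1) D 0 s * m a b * U 0 s.
Local Notation T := tensor_act.

Lemma fuseZ c X a b e f : fuse (c *: X) a b e f = c *: fuse X a b e f.
Proof.
rewrite /fuse scaler_sumr; apply: eq_bigr => i _; rewrite scaler_sumr.
by apply: eq_bigr => j _; rewrite -scalerAr -scalerAl !scalerA mulrC.
Qed.

Lemma fuseD X Y a b e f :
  fuse (X + Y) a b e f = fuse X a b e f + fuse Y a b e f.
Proof.
rewrite /fuse -big_split; apply: eq_bigr => i _; rewrite -big_split.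
by apply: eq_bigr => j _; rewrite mulrDr mulrDl scalerDr.
Qed.

Lemma fuseB X Y a b e f :
  fuse (X - Y) a b e f = fuse X a b e f - fuse Y a b e f.
Proof. by rewrite -scaleN1r fuseD fuseZ scaleN1r. Qed.

Lemma fuse_sum N (X : nat -> A) a b e f :
  fuse (\sum_(0 <= j < N) X j) a b e f = \sum_(0 <= j < N) fuse (X j) a b e f.
Proof.
elim: N => [|N IH]; last by rewrite !big_nat_recr //= -IH fuseD.
by rewrite !big_geq // -[X in fuse X](subrr 0) fuseB subrr.
Qed.

Lemma fuse_comm X Y Z a b e f : (forall a b, GRing.comm (m a b) X) ->
  (forall a b, GRing.comm (m a b) Z) ->
  fuse (X * Y * Z) a b e f = X * fuse Y a b e f * Z.
Proof.
move=> mX mZ; rewrite /fuse mulr_sumr mulr_suml; apply: eq_bigr => i _.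
rewrite mulr_sumr mulr_suml; apply: eq_bigr => j _.
rewrite -scalerAr -scalerAl; congr (_ *: _).
by rewrite !mulrA (mX j e) -!mulrA (mZ a i).
Qed.

Lemma comm_chain s a b : (s < k)%N ->
  GRing.comm (m a b) (D 1 s) /\ GRing.comm (m a b) (U 1 s).
Proof.
elim: s => [|s IH] sk; first by split; apply: commr1.
have [D1 U1] := IH (ltnW sk).
by split; apply: commrM => //; apply: m_y.
Qed.

(** The Hecke relation replaces the two adjacent letters in the middle by 1
    minus lambda times a single letter; the word with the single letter has
    chains of different lengths, so [uchain_dchain_ge] leaves just one y_1
    in it. *)
Lemma uchain_dchain_diag s : (s <= k)%N ->
  U 0 s * D 0 s = 1 - lam *: \sum_(0 <= j < s) D 1 j * y 1 * U 1 j.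
Proof.
elim: s => [|s IH] sk; first by rewrite big_geq // mulr1 scaler0 subr0.
rewrite big_nat_recr //= scalerDr opprD addrA -IH ?(ltnW sk) // add0n.
rewrite -(uchain_dchain_ge y_braid y_far (leqnn s) sk) /= add0n.
rewrite -!mulrA [y _ * (_ * _)]mulrA y_quad ?sk // mulrBl mul1r mulrBr.
by rewrite -scalerAl -scalerAr.
Qed.

Lemma fuse_chain s t a b e f : (s <= t)%N -> (t < k)%N ->
  fuse (D 1 s * y 1 * U 1 t) a b e f = D 1 s * G a b e f * U 1 t /\
  fuse (D 1 t * y 1 * U 1 s) a b e f = D 1 t * G a b e f * U 1 s.
Proof.
move=> st tk; have sk := leq_ltn_trans st tk; have k0 :=
  leq_ltn_trans (leq0n _) tk.
by split; rewrite -fuse_y //; apply: fuse_comm => a' b';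
   have [] := comm_chain a' b' sk; have [] := comm_chain a' b' tk.
Qed.

(** For j < s, the terms (j, s) and (s, j) of X together with the j-th part
    of the diagonal term (s, s), stripped of the outer words that they
    share. *)
Definition cross_term a b e f : A :=
  G a b e f * y 1 + y 1 * G a b e f - lam *: (y 1 * G a b e f * y 1).

(** The double sum is split into its diagonal and the pairs j < s. The
    diagonal contributes T plus a sum over j < s produced by the Hecke
    relation, and this sum is exactly what completes each pair to a
    [cross_term]. *)
Lemma fuse_tensor a b e f :
  \sum_(c : I) \sum_(d : I) r c b d f *: (T d e * T a c) =
  (b == f)%:R *: T a e +
  \sum_(0 <= s < k.+1) \sum_(0 <= j < s)
    D 0 j * D 1 s.-1 * cross_term a b e f * (U 1 s.-1 * U 0 j).
Proof.
transitivity (\sum_(0 <= s < k.+1) \sum_(0 <= t < k.+1)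
    D 0 s * fuse (U 0 s * D 0 t) a b e f * U 0 t).
  transitivity (\sum_(c : I) \sum_(d : I) \sum_(0 <= s < k.+1)
    \sum_(0 <= t < k.+1)
      D 0 s * (r c b d f *: (m d e * (U 0 s * D 0 t) * m a c)) * U 0 t).
    apply: eq_bigr => c _; apply: eq_bigr => d _.
    rewrite mulr_suml scaler_sumr; apply: eq_bigr => s _.
    rewrite mulr_sumr scaler_sumr; apply: eq_bigr => t _.
    by rewrite -scalerAr -scalerAl !mulrA.
  under eq_bigr => c _ do rewrite exchange_big /=.
  rewrite exchange_big /=; apply: eq_bigr => s _.
  under eq_bigr => c _ do rewrite exchange_big /=.
  rewrite exchange_big /=; apply: eq_bigr => t _.
  rewrite mulr_sumr mulr_suml; apply: eq_bigr => c _.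
  by rewrite mulr_sumr mulr_suml; apply: eq_bigr.
rewrite sum_square_diag big_split /=.
have diag : \sum_(0 <= s < k.+1) D 0 s * fuse (U 0 s * D 0 s) a b e f * U 0 s =
  (b == f)%:R *: T a e -
  \sum_(0 <= s < k.+1) \sum_(0 <= j < s)
     lam *: (D 0 s * D 1 j * G a b e f * (U 1 j * U 0 s)).
  rewrite /T scaler_sumr -sumrB; apply: eq_big_nat => s /andP[_ sk].
  rewrite uchain_dchain_diag // fuseB fuseZ fuse_sum fuse1.
  rewrite mulrBr mulrBl -!scalerAr -!scalerAl; congr (_ - _).
  rewrite mulr_sumr mulr_suml scaler_sumr; apply: eq_big_nat => j /andP[_ js].
  have jk : (j < k)%N by apply: leq_trans js _.
  by have [-> _] := fuse_chain a b e f (leqnn j) jk; rewrite !mulrA.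
rewrite diag -addrA [- _ + _]addrC -sumrB; congr (_ + _);
  apply: eq_big_nat => s /andP[_ sk].
rewrite -sumrB; apply: eq_big_nat => j /andP[_].
case: s sk => // s sk; rewrite !ltnS /= => js.
rewrite (uchain_dchain y_braid y_far js sk)
  (uchain_dchain_ge y_braid y_far js sk).
have [E1 E2] := fuse_chain a b e f js sk; rewrite E1 E2.
set g := G a b e f.
have -> : D 0 j * (D 1 s * g * U 1 j) * U 0 s.+1 =
    D 0 j * D 1 s * g * (U 1 j * U 0 s.+1) by rewrite !mulrA.
have -> : D 0 s.+1 * (D 1 j * g * U 1 s) * U 0 j =
    D 0 s.+1 * D 1 j * g * (U 1 s * U 0 j) by rewrite !mulrA.
rewrite (dchain_dchain y_braid y_far js sk) (uchain_uchain y_braid y_far js sk).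
rewrite /cross_term -/g mulrBr mulrDr mulrBl mulrDl -!scalerAr -!scalerAl.
by rewrite !mulrA.
Qed.

Lemma y1_inv :
  (0 < k)%N -> y 1 * (y 1 + lam%:A) = 1 /\ (y 1 + lam%:A) * y 1 = 1.
Proof.
move=> k0; rewrite mulrDr mulrDl y_quad // -scalerAr -scalerAl mulr1 mul1r.
by rewrite subrK.
Qed.

(** Both sides equal G + y_1 G y_1, because y_1 + lambda is inverse to y_1. *)
Lemma cross_term_comm i j e f : (0 < k)%N ->
  \sum_a \sum_b r i j a b *: cross_term a b e f =
  \sum_a \sum_b r a b e f *: cross_term i j a b.
Proof.
move=> k0; have [yz zy] := y1_inv k0; set z := y 1 + lam%:A in yz zy.
transitivity (G i j e f + y 1 * G i j e f * y 1).
  transitivity ((\sum_a \sum_b r i j a b *: G a b e f) * y 1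
     + y 1 * (\sum_a \sum_b r i j a b *: G a b e f)
     - lam *: (y 1 * (\sum_a \sum_b r i j a b *: G a b e f) * y 1)).
    rewrite mulr_sumr !mulr_suml scaler_sumr -big_split -sumrB;
      apply: eq_bigr => a _.
    rewrite mulr_sumr !mulr_suml scaler_sumr -big_split -sumrB;
      apply: eq_bigr => b _.
    rewrite /cross_term scalerBr scalerDr -!scalerAr -!scalerAl /=.
    by rewrite !scalerA [lam * _]mulrC.
  rewrite rG // -/z -!mulrA zy mulr1 -addrA; congr (_ + _).
  by rewrite /z mulrDr -scalerAr mulr1 mulrDr -scalerAr addrK.
transitivity (y 1 * (\sum_a \sum_b r a b e f *: G i j a b)
     + (\sum_a \sum_b r a b e f *: G i j a b) * y 1
     - lam *: (y 1 * (\sum_a \sum_b r a b e f *: G i j a b) * y 1)).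
  rewrite Gr // -/z !mulrA yz mul1r -addrA; congr (_ + _).
  by rewrite /z mulrDl -scalerAl mul1r mulrDl -scalerAl addrK.
rewrite mulr_sumr !mulr_suml scaler_sumr -big_split -sumrB;
  apply: eq_bigr => a _.
rewrite mulr_sumr !mulr_suml scaler_sumr -big_split -sumrB;
  apply: eq_bigr => b _.
rewrite /cross_term scalerBr scalerDr -!scalerAr -!scalerAl /=
  [_ *: (y 1 * _) + _]addrC.
by rewrite !scalerA [lam * _]mulrC.
Qed.

(** The reflection equation with the products of entries reversed. Its
    quadratic terms are R X and X R, where X is expanded by [fuse_tensor]:
    the part T delta of X yields the linear terms, and the rest commutes
    with R by [cross_term_comm]. *)
Theorem tensor_act_reflection i j e f :
  \sum_a \sum_b \sum_c \sum_d (r i j a b * r c b d f) *: (T d e * T a c)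
  - \sum_a \sum_b \sum_c \sum_d (r a j b c * r d c e f) *: (T b d * T i a)
  = \sum_a r i j a f *: T a e - \sum_d r d j e f *: T i d.
Proof.
pose X a b e f := \sum_(c : I) \sum_(d : I) r c b d f *: (T d e * T a c).
pose H a b e f := \sum_(0 <= s < k.+1) \sum_(0 <= t < s)
    D 0 t * D 1 s.-1 * cross_term a b e f * (U 1 s.-1 * U 0 t).
have XE a b e' f' : X a b e' f' = (b == f')%:R *: T a e' + H a b e' f'.
  exact: fuse_tensor.
transitivity (\sum_a \sum_b r i j a b *: X a b e f - \sum_d \sum_c r d c e f *:
  X i j d c).
  congr (_ - _).
    apply: eq_bigr => a _; apply: eq_bigr => b _; rewrite scaler_sumr.
    apply: eq_bigr => c _; rewrite scaler_sumr.
    by apply: eq_bigr => d _; rewrite scalerA.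
  symmetry; rewrite exchange_big pair_big /=.
  transitivity (\sum_(p : I * I) \sum_(x : I * I)
      (r x.1 j x.2 p.1 * r p.2 p.1 e f) *: (T x.2 p.2 * T i x.1)).
    apply: eq_bigr => p _; rewrite /X pair_big scaler_sumr.
    by apply: eq_bigr => x _; rewrite scalerA mulrC.
  rewrite exchange_big [RHS]pair_big /=; apply: eq_bigr => x _.
  by rewrite [RHS]pair_big.
have -> : \sum_a \sum_b r i j a b *: X a b e f =
    \sum_a r i j a f *: T a e + \sum_a \sum_b r i j a b *: H a b e f.
  rewrite -big_split; apply: eq_bigr => a _ /=.
  under eq_bigr => b _ do rewrite XE scalerDr scalerA.
  rewrite big_split /= (bigD1 f) //= eqxx mulr1 big1 ?addr0 // => b /negPf->.
  by rewrite mulr0 scale0r.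
have -> : \sum_d \sum_c r d c e f *: X i j d c =
    \sum_d r d j e f *: T i d + \sum_d \sum_c r d c e f *: H i j d c.
  rewrite -big_split; apply: eq_bigr => a _ /=.
  under eq_bigr => b _ do rewrite XE scalerDr scalerA.
  rewrite big_split /= (bigD1 j) //= eqxx mulr1 big1 ?addr0 // => b /negPf.
  by rewrite eq_sym => ->; rewrite mulr0 scale0r.
suff -> : \sum_a \sum_b r i j a b *: H a b e f =
  \sum_d \sum_c r d c e f *: H i j d c.
  by rewrite opprD addrACA subrr addr0.
have dist (w : I -> I -> F) (M : I -> I -> A) :
    \sum_a \sum_b w a b *: (\sum_(0 <= s < k.+1) \sum_(0 <= t < s)
      D 0 t * D 1 s.-1 * M a b * (U 1 s.-1 * U 0 t)) =
    \sum_(0 <= s < k.+1) \sum_(0 <= t < s)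
      D 0 t * D 1 s.-1 * (\sum_a \sum_b w a b *: M a b) * (U 1 s.-1 * U 0 t).
  rewrite pair_big /=; under eq_bigr => p _ do rewrite scaler_sumr.
  rewrite exchange_big /=; apply: eq_bigr => s _.
  under eq_bigr => p _ do rewrite scaler_sumr.
  rewrite exchange_big /=; apply: eq_bigr => t _.
  rewrite pair_big /= mulr_sumr mulr_suml; apply: eq_bigr => p _.
  by rewrite -scalerAr -scalerAl.
rewrite /H !dist; apply: eq_big_nat => s /andP[_ sk].
apply: eq_big_nat => t /andP[_ ts]; rewrite cross_term_comm //.
exact: leq_trans (leq_ltn_trans (leq0n t) ts) sk.
Qed.
End Fusion.

(** * Entries and legs of tensor matrices *)

Section Entries.
Variables (A : pzRingType) (T : finType).
Implicit Types X Y : 'M[A]_#|T|.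

Lemma ent_of_ent (f : T -> T -> A) I J : ent (of_ent f) I J = f I J.
Proof. by rewrite /ent mxE !enum_rankK. Qed.

Lemma ent_inj X Y : (forall I J, ent X I J = ent Y I J) -> X = Y.
Proof.
move=> E; apply/matrixP => a b.
by have := E (enum_val a) (enum_val b); rewrite /ent !enum_valK.
Qed.

Lemma sum_enum_rank (h : 'I_#|T| -> A) :
  \sum_a h a = \sum_(I : T) h (enum_rank I).
Proof.
by rewrite (reindex (@enum_rank T)) //; exact: onW_bij (@enum_rank_bij T).
Qed.

Lemma ent_mul X Y I J : ent (X *m Y) I J = \sum_K ent X I K * ent Y K J.
Proof. by rewrite /ent mxE sum_enum_rank. Qed.

Lemma ent1 I J : ent (1%:M : 'M[A]_#|T|) I J = (I == J)%:R.
Proof. by rewrite /ent mxE (inj_eq enum_rank_inj). Qed.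

Lemma entD X Y I J : ent (X + Y) I J = ent X I J + ent Y I J.
Proof. by rewrite /ent mxE. Qed.

Lemma entB X Y I J : ent (X - Y) I J = ent X I J - ent Y I J.
Proof. by rewrite /ent !mxE. Qed.

Lemma entZ c X I J : ent (c *: X) I J = c * ent X I J.
Proof. by rewrite /ent mxE. Qed.
End Entries.

Lemma sum_deltar (A : pzRingType) (T : finType) (h : T -> A) b :
  \sum_a h a * (a == b)%:R = h b.
Proof.
rewrite (bigD1 b) //= eqxx mulr1 big1 ?addr0 // => a /negPf->.
by rewrite mulr0.
Qed.

Lemma sum_deltal (A : pzRingType) (T : finType) (h : T -> A) b :
  \sum_a (a == b)%:R * h a = h b.
Proof.
rewrite (bigD1 b) //= eqxx mul1r big1 ?addr0 // => a /negPf->.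
by rewrite mul0r.
Qed.

(** The position lists for which [leg] is the honest embedding of m factors
    into k + 1 factors. *)
Definition leg_ok k m (s : seq nat) :=
  [&& size s == m, uniq s & all (fun x => 0 < x <= k.+1)%N s].

Section Leg.
Variables (n : nat).

Definition pos k m (s : seq nat) (a : 'I_m) : 'I_k.+1 := inord (nth 0%N s a).-1.
Arguments pos k {m} s a.

(** The two maps through which a leg sees a multi-index: [restrict] reads
    the entries at the positions s, and [override] replaces them. *)
Definition restrict k m s (I : mindex n k.+1) : mindex n m :=
  [ffun a : 'I_m => I (pos k s a)].

Definition override k m s (I : mindex n k.+1) (L : mindex n m) : mindex n k.+1
  :=
  [ffun l : 'I_k.+1 => if insub (index l.+1 s) is Some a then L a else I l].

Section OneLeg.
Variables (k m : nat) (s : seq nat).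
Hypothesis ok : leg_ok k m s.
Implicit Types (I J : mindex n k.+1) (L : mindex n m).

Lemma val_pos (a : 'I_m) : (pos k s a).+1 = nth 0%N s a.
Proof.
case/and3P: ok => /eqP sz _ /(all_nthP 0%N)/(_ a);
  rewrite sz ltn_ord => /(_ isT).
by rewrite /pos; case: (nth _ _ _) => // x xk; rewrite inordK.
Qed.

Lemma index_pos (a : 'I_m) : index (pos k s a).+1 s = a.
Proof.
by rewrite val_pos; case/and3P: ok => /eqP sz us _; rewrite index_uniq ?sz.
Qed.

Lemma pos_in (a : 'I_m) : (pos k s a).+1 \in s.
Proof. by rewrite val_pos mem_nth //; case/and3P: ok => /eqP->. Qed.

Lemma overrideN I (L : mindex n m) (l : 'I_k.+1) :
  l.+1 \notin s -> override s I L l = I l.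
Proof.
move=> ls; rewrite ffunE insubN // -leqNgt.
by case/and3P: ok => /eqP<- _ _; rewrite leqNgt index_mem.
Qed.

Lemma override_pos I (L : mindex n m) a : override s I L (pos k s a) = L a.
Proof. by rewrite ffunE index_pos valK. Qed.

Lemma posP (l : 'I_k.+1) : l.+1 \in s -> exists a : 'I_m, l = pos k s a.
Proof.
move=> ls; have lt : (index l.+1 s < m)%N.
  by case/and3P: ok => /eqP<- _ _; rewrite index_mem.
exists (Ordinal lt); apply/val_inj/succn_inj; rewrite val_pos /=.
by rewrite nth_index.
Qed.

Lemma restrict_override I (L : mindex n m) : restrict m s (override s I L) = L.
Proof. by apply/ffunP => a; rewrite ffunE override_pos. Qed.

Lemma override_override I (L L' : mindex n m) :
  override s (override s I L) L' = override s I L'.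
Proof.
apply/ffunP => l; have [ls|ls] := boolP (l.+1 \in s);
  last by rewrite !overrideN.
by have [a ->] := posP ls; rewrite !override_pos.
Qed.

Lemma override_restrict I : override s I (restrict m s I) = I.
Proof.
apply/ffunP => l; have [ls|ls] := boolP (l.+1 \in s); last by rewrite overrideN.
by have [a ->] := posP ls; rewrite override_pos ffunE.
Qed.

Variable A : pzRingType.
Implicit Types X : tmx A n m.

(** This form replaces the case distinction in the definition of [leg] by a
    sum over the new entries at the positions s, which makes composites
    computable. *)
Lemma ent_leg X I J : ent (leg k s X) I J =
  \sum_L ent X (restrict m s I) L * (override s I L == J)%:R.
Proof.
rewrite ent_of_ent /=; case: ifP => [/forallP cond|cond].
  rewrite (bigD1 (restrict m s J)) //= big1 ?addr0 => [|L Lne].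
    have -> : override s I (restrict m s J) = J; last by rewrite eqxx mulr1.
    apply/ffunP => l; have [ls|ls] := boolP (l.+1 \in s).
      by have [a ->] := posP ls; rewrite override_pos ffunE.
    by rewrite overrideN //; have := cond l; rewrite (negPf ls) => /eqP.
  case: eqP => [E|_]; last by rewrite mulr0.
  by rewrite -E restrict_override eqxx in Lne.
rewrite big1 // => L _; case: eqP => [E|]; last by rewrite mulr0.
case/negP: cond; apply/forallP => l; have [//|ls] := boolP (l.+1 \in s).
by rewrite /= -E overrideN.
Qed.

Lemma ent_legM X (Y : tmx A n k.+1) I J : ent (leg k s X *m Y) I J =
  \sum_L ent X (restrict m s I) L * ent Y (override s I L) J.
Proof.
rewrite ent_mul; under eq_bigr => K _ do rewrite ent_leg mulr_suml.
rewrite exchange_big; apply: eq_bigr => L _ /=.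
under eq_bigr => K _ do rewrite -mulrA eq_sym.
by rewrite -mulr_sumr sum_deltal.
Qed.

Lemma legM X Y : leg k s (X *m Y) = leg k s X *m leg k s Y.
Proof.
apply: ent_inj => I J; rewrite ent_legM ent_leg.
under eq_bigr => L _ do rewrite ent_mul mulr_suml.
rewrite exchange_big /=; apply: eq_bigr => L _; rewrite ent_leg mulr_sumr.
by apply: eq_bigr => L' _; rewrite restrict_override override_override mulrA.
Qed.

Lemma leg1 : leg k s (1%:M : tmx A n m) = 1%:M.
Proof.
apply: ent_inj => I J; rewrite ent_leg.
under eq_bigr => L _ do rewrite ent1 eq_sym.
by rewrite sum_deltal override_restrict ent1.
Qed.

Lemma legD X Y : leg k s (X + Y) = leg k s X + leg k s Y.
Proof.
apply: ent_inj => I J; rewrite entD !ent_of_ent /=; case: ifP => _;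
  rewrite ?addr0 //.
exact: entD.
Qed.

Lemma legB X Y : leg k s (X - Y) = leg k s X - leg k s Y.
Proof.
apply: ent_inj => I J; rewrite entB !ent_of_ent /=; case: ifP => _;
  rewrite ?subr0 //.
exact: entB.
Qed.

Lemma legZ c X : leg k s (c *: X) = c *: leg k s X.
Proof.
apply: ent_inj => I J; rewrite entZ !ent_of_ent /=; case: ifP => _;
  rewrite ?mulr0 //.
exact: entZ.
Qed.

Lemma leg_sum (T : finType) (X : T -> tmx A n m) :
  leg k s (\sum_t X t) = \sum_t leg k s (X t).
Proof.
by apply: (big_morph _ legD); rewrite -(subrr 0) legB subrr.
Qed.
End OneLeg.

Lemma leg_leg (A : pzRingType) k m l s t (X : tmx A n l) :
  leg_ok k m.+1 s -> leg_ok m l t ->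
  leg k s (leg m t X) = leg k [seq nth 0%N s x.-1 | x <- t] X.
Proof.
move=> oks okt; set u := map _ t.
have oku : leg_ok k l u.
  case/and3P: oks => /eqP szs us /allP as_;
    case/and3P: okt => /eqP szt ut /allP at_.
  apply/and3P; split; first by rewrite size_map szt.
    rewrite map_inj_in_uniq // => x x' /at_/andP[x0 xm] /at_/andP[x0' xm'] /eqP.
    rewrite nth_uniq // ?szs ?prednK //.
    by case: x x' x0 x0' {xm xm'} => [|x] [|x'] // _ _ /eqP /= ->.
  apply/allP => _ /mapP[x /at_/andP[x0 xm] ->]; apply/as_/mem_nth.
  by rewrite szs prednK.
have posu (a : 'I_l) : pos k u a = pos k s (pos m t a).
  apply/val_inj/succn_inj; rewrite !val_pos // /u  (nth_map 0%N); last first.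
    by case/and3P: okt => /eqP->.
  by rewrite -(val_pos okt).
apply: ent_inj => I J; rewrite !ent_leg //.
under eq_bigr => L _ do rewrite ent_leg // mulr_suml.
rewrite exchange_big; apply: eq_bigr => L _ /=.
under eq_bigr => K _ do rewrite -mulrA eq_sym.
rewrite -mulr_sumr sum_deltal; congr (ent X _ _ * (_ == J)%:R).
  by apply/ffunP => a; rewrite !ffunE posu.
apply/ffunP => x; have [xs|xs] := boolP (x.+1 \in s); last first.
  rewrite !overrideN //; apply: contra xs => /mapP[z zt ->].
  case/and3P: oks => /eqP szs us _;
    case/and3P: okt => _ _ /allP/(_ z zt)/andP[z0 zm].
  by rewrite mem_nth // szs prednK.
have [a ->] := posP oks xs; rewrite override_pos //.
have [at_|at_] := boolP (a.+1 \in t).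
  by have [b ->] := posP okt at_; rewrite override_pos // -posu override_pos.
rewrite overrideN // ffunE overrideN // val_pos //.
apply: contra at_ => /mapP[z zt].
case/and3P: oks => /eqP szs us _;
  case/and3P: (okt) => _ _ /allP/(_ z zt)/andP[z0 zm].
by move/eqP; rewrite nth_uniq ?szs ?prednK // => /eqP ->; rewrite prednK.
Qed.

Lemma leg_comm (A : comNzRingType) k m l s t (X : tmx A n m) (Y : tmx A n l) :
  leg_ok k m s -> leg_ok k l t -> ~~ has (mem s) t ->
  leg k s X *m leg k t Y = leg k t Y *m leg k s X.
Proof.
move=> oks okt /hasPn dis; have dis' x : x \in s -> x \notin t.
  by move=> xs; apply/negP => /dis; rewrite /= xs.
apply: ent_inj => I J; rewrite !ent_legM //.
under eq_bigr => L _ do rewrite ent_leg // mulr_sumr.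
rewrite exchange_big; apply: eq_bigr => L _ /=.
rewrite ent_leg // mulr_sumr; apply: eq_bigr => K _.
have -> : restrict l t (override s I K) = restrict l t I.
  by apply/ffunP => a; rewrite [LHS]ffunE [RHS]ffunE overrideN //;
    apply/dis/pos_in.
have -> : restrict m s (override t I L) = restrict m s I.
  by apply/ffunP => a; rewrite [LHS]ffunE [RHS]ffunE overrideN //;
    apply/dis'/pos_in.
rewrite mulrCA; do 2!congr (_ * _); congr (_ == _)%:R.
apply/ffunP => x; have [xs|xs] := boolP (x.+1 \in s).
  rewrite overrideN //; last by apply: dis'.
  by have [a ->] := posP oks xs; rewrite !override_pos.
rewrite [RHS]overrideN //; have [xt|xt] := boolP (x.+1 \in t).
  by have [a ->] := posP okt xt; rewrite !override_pos.
by rewrite !overrideN.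
Qed.
End Leg.

(** * The matrix B of a skew-inverse *)

(** Tensors with four indices are functions r i j k l, rows i, j first.
    Sums over two indices are sums over pairs. *)
Section SkewTrace.
Variables (F : comNzRingType) (I : finType) (r psi : I -> I -> I -> I -> F).

Hypothesis skew_l : forall i j k l,
  \sum_(p : I * I) r i p.1 j p.2 * psi p.2 k p.1 l = (i == l)%:R * (j == k)%:R.
Hypothesis skew_r : forall i j k l,
  \sum_(p : I * I) psi i p.1 j p.2 * r p.2 k p.1 l = (i == l)%:R * (j == k)%:R.

Definition skewB i j := \sum_a psi a i a j.
Local Notation B := skewB.

Lemma skewB_trace b l :
  \sum_(p : I * I) B p.2 p.1 * r p.1 b p.2 l = (b == l)%:R.
Proof.
under eq_bigr => p _ do rewrite mulr_suml.
rewrite exchange_big /=; transitivity (\sum_a (a == l)%:R * (a == b)%:R : F).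
  apply: eq_bigr => a _; rewrite -skew_r.
  by rewrite [RHS](reindex (fun p : I * I => (p.2, p.1))) //=;
    exists (fun p => (p.2, p.1)); case.
by rewrite sum_deltal; rewrite eq_sym.
Qed.

(** Let D be the contraction on the left, as a tensor in b, h, f, y. Taking
    the B-weighted trace over factor 1 of R_12 R_23 R_12^-1 = R_23^-1 R_12
    R_23 and using [skewB_trace], the contraction of D with r is the
    identity (this is [claim]). Contracting with the skew-inverse psi
    solves for D. It is stated for x, x' so as to cover both x = R, x' =
    R^-1 and x = R^-1, x' = R. *)
Lemma skewB_exchange (x x' : I -> I -> I -> I -> F) :
  (forall c b g e y z,
     \sum_(w : I * I) \sum_d x c b d w.1 * r w.1 g w.2 z * x' d w.2 e y =
     \sum_(v : I * I) \sum_a x' b g v.1 v.2 * r c v.1 e a * x a v.2 y z) ->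
  (forall i j k l,
     \sum_(v : I * I) x' i j v.1 v.2 * x v.1 v.2 k l =
     (i == k)%:R * (j == l)%:R) ->
  forall b h f y,
    \sum_(p : I * I) B p.2 p.1 * (\sum_d x p.1 b d f * x' d h p.2 y) =
    (b == y)%:R * B h f.
Proof.
move=> yb x'x b h f y.
pose Dt h f := \sum_(p : I * I) B p.2 p.1 * (\sum_d x p.1 b d f * x' d h p.2 y).
have claim g z : \sum_(w : I * I) Dt w.2 w.1 * r w.1 g w.2 z =
  (b == y)%:R * (g == z)%:R.
  transitivity (\sum_(p : I * I) B p.2 p.1 *
      \sum_(w : I * I) \sum_d x p.1 b d w.1 * r w.1 g w.2 z * x' d w.2 p.2 y).
    under eq_bigr => w _ do rewrite mulr_suml.
    rewrite exchange_big; apply: eq_bigr => p _ /=; rewrite mulr_sumr.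
    apply: eq_bigr => w _; rewrite -mulrA; congr (_ * _).
    by rewrite mulr_suml; apply: eq_bigr => d _; rewrite mulrAC.
  under eq_bigr => p _ do rewrite yb mulr_sumr.
  rewrite exchange_big -x'x; apply: eq_bigr => v _ /=.
  under eq_bigr => p _ do rewrite mulr_sumr.
  rewrite exchange_big /=.
  transitivity (\sum_a x' b g v.1 v.2 * x a v.2 y z * (v.1 == a)%:R).
    apply: eq_bigr => a _; rewrite -skewB_trace mulr_sumr;
      apply: eq_bigr => p _.
    by rewrite mulrCA -!mulrA; congr (_ * _); rewrite mulrCA [RHS]mulrC mulrA.
  by under eq_bigr => a _ do rewrite eq_sym; rewrite sum_deltar.
have <- : \sum_(p : I * I) (b == y)%:R * (p.1 == p.2)%:R * psi p.2 h p.1 f =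
    (b == y)%:R * B h f.
  rewrite -(pair_bigA _ (fun g z => (b == y)%:R * (g == z)%:R * psi z h g f))
    /=.
  rewrite [RHS]mulr_sumr; apply: eq_bigr => g _.
  under eq_bigr => z _ do rewrite -mulrA [g == _]eq_sym.
  by rewrite -mulr_sumr sum_deltal.
under [RHS]eq_bigr => p _ do rewrite -claim mulr_suml.
rewrite exchange_big /= -[LHS]/(Dt h f).
transitivity (\sum_(w : I * I) Dt w.2 w.1 * ((w.1 == f)%:R * (w.2 == h)%:R)).
  rewrite -(pair_bigA _ (fun c d => Dt d c * ((c == f)%:R * (d == h)%:R))) /=.
  rewrite exchange_big /= -[LHS](sum_deltar (fun h => Dt h f));
    apply: eq_bigr => d _.
  rewrite -[in LHS](sum_deltar (Dt d)) mulr_suml; apply: eq_bigr => c _.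
  by rewrite mulrA.
apply: eq_bigr => w _; rewrite -skew_l mulr_sumr; apply: eq_bigr => p _.
by rewrite mulrA.
Qed.

Variables (s : I -> I -> I -> I -> F) (lam : F).
Hypothesis rE :
  forall i j k l, r i j k l = s i j k l + lam * ((i == k)%:R * (j == l)%:R).
Hypothesis rs : forall i j k l,
  \sum_(v : I * I) r i j v.1 v.2 * s v.1 v.2 k l = (i == k)%:R * (j == l)%:R.
Hypothesis sr : forall i j k l,
  \sum_(v : I * I) s i j v.1 v.2 * r v.1 v.2 k l = (i == k)%:R * (j == l)%:R.
Hypothesis yb_rs : forall c b g e y z,
  \sum_(w : I * I) \sum_d r c b d w.1 * r w.1 g w.2 z * s d w.2 e y =
  \sum_(v : I * I) \sum_a s b g v.1 v.2 * r c v.1 e a * r a v.2 y z.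
Hypothesis yb_sr : forall c b g e y z,
  \sum_(w : I * I) \sum_d s c b d w.1 * r w.1 g w.2 z * r d w.2 e y =
  \sum_(v : I * I) \sum_a r b g v.1 v.2 * r c v.1 e a * s a v.2 y z.

Lemma sum_delta2 (h : I -> I -> F) k l :
  \sum_(p : I * I) h p.1 p.2 * ((p.1 == k)%:R * (p.2 == l)%:R) = h k l.
Proof.
rewrite -(pair_bigA _ (fun c d => h c d * ((c == k)%:R * (d == l)%:R))) /=.
rewrite exchange_big /= -[RHS](sum_deltar (h k)); apply: eq_bigr => d _.
rewrite -[in RHS](sum_deltar (h^~ d)) mulr_suml; apply: eq_bigr => c _.
by rewrite mulrA.
Qed.

(** This and the next lemma express the inverse of R through the
    skew-inverse, on either side of B. They follow from the two instances
    of [skewB_exchange] by contracting with psi so as to remove the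
    remaining factor r. *)
Lemma skewB_psi_l h k y l :
  \sum_e B e l * s k h e y = \sum_f B h f * psi f k y l.
Proof.
have <- : \sum_(p : I * I) (p.1 == y)%:R * B h p.2 * psi p.2 k p.1 l =
    \sum_f B h f * psi f k y l.
  rewrite -(pair_bigA _ (fun b f => (b == y)%:R * B h f * psi f k b l)) /=.
  rewrite exchange_big; apply: eq_bigr => f _ /=.
  by under eq_bigr => b _ do rewrite -mulrA; rewrite sum_deltal.
under [RHS]eq_bigr => p _ do rewrite -(skewB_exchange yb_rs sr) mulr_suml.
rewrite [RHS]exchange_big /=.
transitivity (\sum_(q : I * I) \sum_d B q.2 q.1 * s d h q.2 y *
    ((q.1 == l)%:R * (d == k)%:R)).
  rewrite -(pair_bigA _
    (fun c e => \sum_d B e c * s d h e y * ((c == l)%:R * (d == k)%:R))).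
  rewrite exchange_big; apply: eq_bigr => e _ /=.
  by rewrite pair_big /= (sum_delta2 (fun c d => B e c * s d h e y)).
apply: eq_bigr => q _; rewrite -[RHS]/(\sum_p _).
under [RHS]eq_bigr => p _ do rewrite mulr_sumr mulr_suml.
rewrite exchange_big; apply: eq_bigr => d _ /=; rewrite -skew_l mulr_sumr.
by apply: eq_bigr => p _; rewrite !mulrA; congr (_ * _); rewrite mulrAC.
Qed.

Lemma skewB_psi_r b k l f :
  \sum_c B k c * s c b l f = \sum_h B h f * psi b k h l.
Proof.
have <- : \sum_(p : I * I) (b == p.2)%:R * B p.1 f * psi p.2 k p.1 l =
    \sum_h B h f * psi b k h l.
  rewrite -(pair_bigA _ (fun h y => (b == y)%:R * B h f * psi y k h l)) /=.
  apply: eq_bigr => h _ /=.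
  by under eq_bigr => y _ do rewrite -mulrA eq_sym; rewrite sum_deltal.
under [RHS]eq_bigr => p _ do rewrite -(skewB_exchange yb_sr rs) mulr_suml.
rewrite [RHS]exchange_big /=.
transitivity (\sum_(q : I * I) \sum_d B q.2 q.1 * s q.1 b d f *
    ((d == l)%:R * (q.2 == k)%:R)).
  rewrite -(pair_bigA _
    (fun c e => \sum_d B e c * s c b d f * ((d == l)%:R * (e == k)%:R))).
  apply: eq_bigr => c _ /=; rewrite exchange_big /=.
  by rewrite pair_big /= (sum_delta2 (fun d e => B e c * s c b d f)).
apply: eq_bigr => q _; under [RHS]eq_bigr => p _ do rewrite mulr_sumr mulr_suml.
rewrite exchange_big; apply: eq_bigr => d _ /=; rewrite -skew_l mulr_sumr.
by apply: eq_bigr => p _; rewrite !mulrA.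
Qed.

(** By the two previous lemmas both sides are the contraction of psi with
    one B on each side. *)
Lemma skewB_comm_s i j k l :
  \sum_(p : I * I) B i p.1 * B j p.2 * s p.1 p.2 k l =
  \sum_(p : I * I) s i j p.1 p.2 * (B p.1 k * B p.2 l).
Proof.
transitivity (\sum_b \sum_h B j b * (B h l * psi b i h k)).
  rewrite -(pair_bigA _ (fun c b => B i c * B j b * s c b k l)) /= exchange_big.
  apply: eq_bigr => b _ /=; rewrite -mulr_sumr -skewB_psi_r mulr_sumr.
  by apply: eq_bigr => c _; rewrite mulrA [B j b * _]mulrC.
rewrite exchange_big -(pair_bigA _ (fun e y => s i j e y * (B e k * B y l))) /=.
rewrite [RHS]exchange_big; apply: eq_bigr => y _ /=.
transitivity (B y l * \sum_e B e k * s i j e y).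
  rewrite skewB_psi_l mulr_sumr; apply: eq_bigr => b _.
  by rewrite mulrCA.
by rewrite mulr_sumr; apply: eq_bigr => e _;
  rewrite mulrA mulrC [B y l * _]mulrC.
Qed.

(** R differs from its inverse by a scalar. *)
Lemma skewB_comm i j k l :
  \sum_(p : I * I) B i p.1 * B j p.2 * r p.1 p.2 k l =
  \sum_(p : I * I) r i j p.1 p.2 * (B p.1 k * B p.2 l).
Proof.
under eq_bigr => p _ do rewrite rE mulrDr mulrCA.
under [RHS]eq_bigr => p _ do rewrite rE mulrDl -mulrA [i == _]eq_sym
  [j == _]eq_sym.
rewrite !big_split /= skewB_comm_s -!mulr_sumr; congr (_ + _ * _).
under [RHS]eq_bigr => p _ do rewrite mulrC.
by rewrite (sum_delta2 (fun c d => B i c * B j d))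
  (sum_delta2 (fun c d => B c k * B d l)).
Qed.
End SkewTrace.

(** * Two and three tensor factors *)

Section SmallTensors.
Variables (n : nat).
Local Notation I := 'I_n.

Definition mk1 (i : I) : mindex n 1 := [ffun=> i].
(** The first index serves as the default value of [nth], which is never
    reached. *)
Definition mk2 (i j : I) : mindex n 2 := [ffun l : 'I_2 => nth i [:: i; j] l].
Definition mk3 (i j k : I) : mindex n 3 :=
  [ffun l : 'I_3 => nth i [:: i; j; k] l].

Lemma mk1_surj (K : mindex n 1) : K = mk1 (K ord0).
Proof. by apply/ffunP => l; rewrite ffunE ord1. Qed.

Lemma mk2_surj (K : mindex n 2) : K = mk2 (K ord0) (K ord_max).
Proof.
apply/ffunP => l; rewrite ffunE; case: l => [[|[|//]] l2] /=; congr (K _);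
  exact: val_inj.
Qed.

Lemma sum_mk1 (A : nmodType) (h : mindex n 1 -> A) :
  \sum_K h K = \sum_i h (mk1 i).
Proof.
rewrite (reindex mk1) //; exists (fun K : mindex n 1 => K ord0) => [i _|K _].
  by rewrite ffunE.
by rewrite [RHS]mk1_surj.
Qed.

Lemma sum_mk2 (A : nmodType) (h : mindex n 2 -> A) :
  \sum_K h K = \sum_(p : I * I) h (mk2 p.1 p.2).
Proof.
rewrite (reindex (fun p : I * I => mk2 p.1 p.2)) //.
exists (fun K : mindex n 2 => (K ord0, K ord_max)) => [[i j] _|K _] /=.
  by rewrite !ffunE.
by rewrite [RHS]mk2_surj.
Qed.

Lemma mk2_eq i j k l : (mk2 i j == mk2 k l) = (i == k) && (j == l).
Proof.
apply/eqP/andP => [E|[/eqP-> /eqP->]//]; split.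
  by have /ffunP/(_ ord0) := E; rewrite !ffunE /= => ->.
by have /ffunP/(_ ord_max) := E; rewrite !ffunE /= => ->.
Qed.

Lemma mk3_eq i j k i' j' k' :
  (mk3 i j k == mk3 i' j' k') = [&& i == i', j == j' & k == k'].
Proof.
apply/eqP/and3P => [E|[/eqP-> /eqP-> /eqP->]//]; split.
- by have /ffunP/(_ ord0) := E; rewrite !ffunE /= => ->.
- by have /ffunP/(_ (Ordinal (isT : 1 < 3)%N)) := E; rewrite !ffunE /= => ->.
by have /ffunP/(_ ord_max) := E; rewrite !ffunE /= => ->.
Qed.

Lemma restrict12 a b c : restrict 2 [:: 1; 2]%N (mk3 a b c) = mk2 a b.
Proof. by apply/ffunP; case=> [[|[|//]] ?]; rewrite !ffunE /pos /= inordK. Qed.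

Lemma restrict23 a b c : restrict 2 [:: 2; 3]%N (mk3 a b c) = mk2 b c.
Proof. by apply/ffunP; case=> [[|[|//]] ?]; rewrite !ffunE /pos /= inordK. Qed.

Lemma restrict21 a b : restrict 2 [:: 2; 1]%N (mk2 a b) = mk2 b a.
Proof. by apply/ffunP; case=> [[|[|//]] ?]; rewrite !ffunE /pos /= inordK. Qed.

Lemma restrict1 a b : restrict 1 [:: 1]%N (mk2 a b) = mk1 a.
Proof. by apply/ffunP; case=> [[|//] ?]; rewrite !ffunE /pos /= inordK. Qed.

Lemma restrict2 a b : restrict 1 [:: 2]%N (mk2 a b) = mk1 b.
Proof. by apply/ffunP; case=> [[|//] ?]; rewrite !ffunE /pos /= inordK. Qed.

Lemma overrideE k m s (I : mindex n k.+1) (L : mindex n m) J : leg_ok k m s ->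
  restrict m s J = L -> (forall l : 'I_k.+1, l.+1 \notin s -> J l = I l) ->
  override s I L = J.
Proof.
move=> ok <- JI; apply/ffunP => l.
have [ls|ls] := boolP (l.+1 \in s); last by rewrite overrideN ?JI.
by have [a ->] := posP ok ls; rewrite override_pos // ffunE.
Qed.

Lemma override12 a b c d e :
  override [:: 1; 2]%N (mk3 a b c) (mk2 d e) = mk3 d e c.
Proof.
apply: overrideE => //; first exact: restrict12.
by case=> [[|[|[|//]]] ?] //; rewrite !ffunE.
Qed.

Lemma override23 a b c d e :
  override [:: 2; 3]%N (mk3 a b c) (mk2 d e) = mk3 a d e.
Proof.
apply: overrideE => //; first exact: restrict23.
by case=> [[|[|[|//]]] ?] //; rewrite !ffunE.
Qed.

Lemma override21 a b d e : override [:: 2; 1]%N (mk2 a b) (mk2 d e) = mk2 e d.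
Proof.
by apply: overrideE => //; [exact: restrict21 | case=> [[|[|//]] ?]].
Qed.

Lemma override1 a b d : override [:: 1]%N (mk2 a b) (mk1 d) = mk2 d b.
Proof.
apply: overrideE => //; first exact: restrict1.
by case=> [[|[|//]] ?] //; rewrite !ffunE.
Qed.

Lemma override2 a b d : override [:: 2]%N (mk2 a b) (mk1 d) = mk2 a d.
Proof.
apply: overrideE => //; first exact: restrict2.
by case=> [[|[|//]] ?] //; rewrite !ffunE.
Qed.

Variable (A : pzRingType).

Definition ent2 (X : tmx A n 2) i j k l : A := ent X (mk2 i j) (mk2 k l).

Lemma ent2M X Y i j k l :
  ent2 (X *m Y) i j k l =
    \sum_(p : I * I) ent2 X i j p.1 p.2 * ent2 Y p.1 p.2 k l.
Proof. by rewrite /ent2 ent_mul sum_mk2. Qed.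

Lemma ent2_1 i j k l : ent2 1%:M i j k l = (i == k)%:R * (j == l)%:R.
Proof. by rewrite /ent2 ent1 mk2_eq -mulnb natrM. Qed.

Lemma ent2_inj X Y : (forall i j k l, ent2 X i j k l = ent2 Y i j k l) -> X = Y.
Proof.
by move=> E; apply: ent_inj => I J; rewrite (mk2_surj I) (mk2_surj J); apply: E.
Qed.

Lemma ent_leg12 (X : tmx A n 2) a b c d e f :
  ent (leg 2 [:: 1; 2]%N X) (mk3 a b c) (mk3 d e f) =
    ent2 X a b d e * (c == f)%:R.
Proof.
rewrite ent_leg // restrict12 sum_mk2 (bigD1 (d, e)) //= override12 mk3_eq !eqxx
  /=.
rewrite big1 ?addr0 // => -[d' e'];
  rewrite xpair_eqE /= override12 mk3_eq andbA.
by move=> /negPf->; rewrite mulr0.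
Qed.

Lemma ent_leg23 (X : tmx A n 2) a b c d e f :
  ent (leg 2 [:: 2; 3]%N X) (mk3 a b c) (mk3 d e f) =
    ent2 X b c e f * (a == d)%:R.
Proof.
rewrite ent_leg // restrict23 sum_mk2 (bigD1 (e, f)) //= override23 mk3_eq !eqxx
  !andbT.
rewrite big1 ?addr0 // => -[d' e']; rewrite xpair_eqE /= override23 mk3_eq.
by move=> /negPf->; rewrite andbF mulr0.
Qed.

Lemma ent_leg12M (X : tmx A n 2) (Y : tmx A n 3) a b c J :
  ent (leg 2 [:: 1; 2]%N X *m Y) (mk3 a b c) J =
  \sum_(p : I * I) ent2 X a b p.1 p.2 * ent Y (mk3 p.1 p.2 c) J.
Proof.
rewrite ent_legM // sum_mk2; apply: eq_bigr => p _.
by rewrite restrict12 override12.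
Qed.

Lemma ent_leg23M (X : tmx A n 2) (Y : tmx A n 3) a b c J :
  ent (leg 2 [:: 2; 3]%N X *m Y) (mk3 a b c) J =
  \sum_(p : I * I) ent2 X b c p.1 p.2 * ent Y (mk3 a p.1 p.2) J.
Proof.
rewrite ent_legM // sum_mk2; apply: eq_bigr => p _.
by rewrite restrict23 override23.
Qed.

Lemma ent2_leg1 (X : 'M[A]_n) i j k l :
  ent2 (leg 1 [:: 1]%N (one_factor X)) i j k l = X i k * (j == l)%:R.
Proof.
rewrite /ent2 ent_leg // sum_mk1 restrict1.
under eq_bigr => c _ do rewrite override1 mk2_eq ent_of_ent !ffunE -mulnb natrM
  mulrA.
by rewrite -mulr_suml sum_deltar.
Qed.

Lemma ent2_leg2 (X : 'M[A]_n) i j k l :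
  ent2 (leg 1 [:: 2]%N (one_factor X)) i j k l = (i == k)%:R * X j l.
Proof.
rewrite /ent2 ent_leg // sum_mk1 restrict2.
under eq_bigr => c _ do rewrite override2 mk2_eq ent_of_ent !ffunE andbC -mulnb
  natrM mulrA.
rewrite -mulr_suml sum_deltar; case: (i == k);
  by rewrite ?mulr1 ?mul1r ?mulr0 ?mul0r.
Qed.

Lemma ent2_leg1M (X : 'M[A]_n) (Y : tmx A n 2) i j k l :
  ent2 (leg 1 [:: 1]%N (one_factor X) *m Y) i j k l =
  \sum_c X i c * ent2 Y c j k l.
Proof.
rewrite /ent2 ent_legM // sum_mk1; apply: eq_bigr => c _.
by rewrite restrict1 override1 ent_of_ent !ffunE.
Qed.

Lemma ent2_legM1 (X : 'M[A]_n) (Y : tmx A n 2) i j k l :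
  ent2 (Y *m leg 1 [:: 1]%N (one_factor X)) i j k l =
  \sum_c ent2 Y i j c l * X c k.
Proof.
rewrite ent2M -(pair_bigA _ (fun c d => ent2 Y i j c d *
  ent2 (leg 1 [:: 1]%N (one_factor X)) c d k l)) /=.
apply: eq_bigr => c _.
under eq_bigr => d _ do rewrite ent2_leg1 mulrA.
by rewrite sum_deltar.
Qed.

Lemma mindex_insert2 a i k :
  mindex_insert (inord 1) a (mk2 i k) = mk3 i a k :> mindex n 3.
Proof.
apply/ffunP => l; rewrite ffunE; case: unliftP => [l' ->|->].
  by rewrite !ffunE /= inordK //; case: l' => [[|[|//]] ?].
by rewrite ffunE inordK.
Qed.

Lemma mindex_insert1 a i :
  mindex_insert (inord 1) a (mk1 i) = mk2 i a :> mindex n 2.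
Proof.
apply/ffunP => l; rewrite ffunE; case: unliftP => [l' ->|->].
  by rewrite !ffunE /= inordK //; case: l' => [[|//] ?].
by rewrite ffunE inordK.
Qed.

Lemma ent2_flip (i j k l : I) :
  ent2 flip_mx i j k l = (i == l)%:R * (j == k)%:R.
Proof. by rewrite /ent2 ent_of_ent !ffunE /= -mulnb natrM. Qed.

Lemma ent2_ptrace (X : tmx A n 3) i j k l :
  ent2 (ptrace 2 X) i j k l = \sum_a ent X (mk3 i a j) (mk3 k a l).
Proof.
by rewrite /ent2 ent_of_ent /=; under eq_bigr => a _ do rewrite !mindex_insert2.
Qed.

End SmallTensors.

(** * Hecke R-matrices *)

Section Hecke.
Variables (F : fieldType) (n : nat) (q : F) (R Psi : tmx F n 2).
Hypotheses (q_neq0 : q != 0) (R_braid : yang_baxter R) (R_hecke : hecke q R).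
Hypothesis R_skew : skew_inverse R Psi.
Local Notation I := 'I_n.

Definition lambda := q - q^-1.
Definition hecke_inv : tmx F n 2 := R - lambda%:M.
Local Notation S := hecke_inv.
Local Notation r := (ent2 R).
Local Notation s := (ent2 S).
Local Notation psi := (ent2 Psi).

(** The Hecke relation reads R (R - lambda) = 1. *)
Lemma mulRS : R *m S = 1%:M.
Proof.
have := R_hecke; rewrite /hecke mulmxDr !mulmxBl -scalar_mxM mulfV // => /eqP.
rewrite addrA subr_eq0 => /eqP <-.
rewrite mulmxBr !mul_mx_scalar mul_scalar_mx scalerBl opprB addrA addrAC.
by rewrite addrC addrA.
Qed.

Lemma mulSR : S *m R = 1%:M. Proof. exact: mulmx1C mulRS. Qed.

Lemma mulSS : S *m S = 1%:M - lambda *: S.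
Proof. by rewrite {2}/S mulmxBr mulSR mul_mx_scalar. Qed.

Lemma leg_mul1 k t (X Y : tmx F n 2) : leg_ok k 2 t -> X *m Y = 1%:M ->
  leg k t X *m leg k t Y = 1%:M.
Proof. by move=> ok XY; rewrite -legM // XY leg1. Qed.

Local Notation R12 := (leg 2 [:: 1; 2]%N R).
Local Notation R23 := (leg 2 [:: 2; 3]%N R).
Local Notation S12 := (leg 2 [:: 1; 2]%N S).
Local Notation S23 := (leg 2 [:: 2; 3]%N S).

Lemma braid_RRS : R12 *m (R23 *m S12) = S23 *m (R12 *m R23).
Proof.
rewrite -[LHS]mul1mx -(@leg_mul1 2 [:: 2; 3]%N _ _ isT mulSR) -!mulmxA.
rewrite [R23 *m (R12 *m _)]mulmxA [_ *m (_ *m S12)]mulmxA -R_braid.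
by rewrite -2!mulmxA (leg_mul1 _ mulRS) // mulmx1.
Qed.

Lemma braid_SRR : S12 *m (R23 *m R12) = R23 *m (R12 *m S23).
Proof.
rewrite -[RHS]mul1mx -(@leg_mul1 2 [:: 1; 2]%N _ _ isT mulSR) -!mulmxA.
rewrite [R12 *m (R23 *m _)]mulmxA [_ *m (_ *m S23)]mulmxA R_braid.
by rewrite -2!mulmxA (leg_mul1 _ mulRS) // mulmx1.
Qed.

Lemma braid_SSS : S12 *m S23 *m S12 = S23 *m S12 *m S23.
Proof.
have i12 := @leg_mul1 2 [:: 1; 2]%N _ _ isT.
have i23 := @leg_mul1 2 [:: 2; 3]%N _ _ isT.
(* Both sides are inverses of the two sides of the Yang-Baxter equation. *)
have L : S23 *m S12 *m S23 *m (R23 *m R12 *m R23) = 1%:M.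
  by rewrite -!mulmxA (mulmxA S23 R23) i23 ?mulSR // mul1mx (mulmxA S12) i12
    ?mulSR // mul1mx i23 ?mulSR.
have E : R12 *m R23 *m R12 *m (S12 *m S23 *m S12) = 1%:M.
  by rewrite -!mulmxA (mulmxA R12 S12) i12 ?mulRS // mul1mx (mulmxA R23) i23
    ?mulRS // mul1mx i12 ?mulRS.
by rewrite -[LHS]mul1mx -L -mulmxA -R_braid E mulmx1.
Qed.

Lemma ent_12_23_12 (X Y Z : tmx F n 2) c b g e y z :
  ent (leg 2 [:: 1; 2]%N X *m (leg 2 [:: 2; 3]%N Y *m leg 2 [:: 1; 2]%N Z))
      (mk3 c b g) (mk3 e y z) =
  \sum_(w : I * I) \sum_d ent2 X c b d w.1 * ent2 Y w.1 g w.2 z * ent2 Z d w.2 e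
    y.
Proof.
rewrite ent_leg12M -(pair_bigA _ (fun d f => ent2 X c b d f *
  ent (leg 2 [:: 2; 3]%N Y *m leg 2 [:: 1; 2]%N Z) (mk3 d f g) (mk3 e y z))) /=.
rewrite -(pair_bigA _
  (fun f h => \sum_d ent2 X c b d f * ent2 Y f g h z * ent2 Z d h e y)).
rewrite [LHS]exchange_big; apply: eq_bigr => f _ /=.
rewrite [RHS]exchange_big; apply: eq_bigr => d _ /=.
rewrite ent_leg23M -(pair_bigA _ (fun h z' => ent2 Y f g h z' *
  ent (leg 2 [:: 1; 2]%N Z) (mk3 d h z') (mk3 e y z))) /= mulr_sumr.
apply: eq_bigr => h _; under eq_bigr => z' _ do rewrite ent_leg12 mulrA.
by rewrite sum_deltar mulrA.
Qed.

Lemma ent_23_12_23 (X Y Z : tmx F n 2) c b g e y z :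
  ent (leg 2 [:: 2; 3]%N X *m (leg 2 [:: 1; 2]%N Y *m leg 2 [:: 2; 3]%N Z))
      (mk3 c b g) (mk3 e y z) =
  \sum_(v : I * I) \sum_a ent2 X b g v.1 v.2 * ent2 Y c v.1 e a * ent2 Z a v.2 y
    z.
Proof.
rewrite ent_leg23M; apply: eq_bigr => v _.
rewrite ent_leg12M -(pair_bigA _ (fun e' a => ent2 Y c v.1 e' a *
  ent (leg 2 [:: 2; 3]%N Z) (mk3 e' a v.2) (mk3 e y z))) /= exchange_big
    mulr_sumr.
apply: eq_bigr => a _ /=; under eq_bigr => e' _ do rewrite ent_leg23 mulrA.
by rewrite sum_deltar mulrA.
Qed.

Lemma ptrace_12_23 (X Y : tmx F n 2) i j k l :
  ent2 (ptrace 2 (leg 2 [:: 1; 2]%N X *m leg 2 [:: 2; 3]%N Y)) i k j l =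
  \sum_(p : I * I) ent2 X i p.1 j p.2 * ent2 Y p.2 k p.1 l.
Proof.
rewrite ent2_ptrace -(pair_bigA _ (fun a b => ent2 X i a j b * ent2 Y b k a l))
  /=.
apply: eq_bigr => a _; rewrite ent_leg12M.
rewrite -(pair_bigA _ (fun c b => ent2 X i a c b *
  ent (leg 2 [:: 2; 3]%N Y) (mk3 c b k) (mk3 j a l))) /= exchange_big.
apply: eq_bigr => b _ /=; under eq_bigr => c _ do rewrite ent_leg23 mulrA.
by rewrite sum_deltar.
Qed.

Lemma skew_l i j k l :
  \sum_(p : I * I) r i p.1 j p.2 * psi p.2 k p.1 l = (i == l)%:R * (j == k)%:R.
Proof. by rewrite -ptrace_12_23 R_skew.1 ent2_flip [k == j]eq_sym. Qed.

Lemma skew_r i j k l :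
  \sum_(p : I * I) psi i p.1 j p.2 * r p.2 k p.1 l = (i == l)%:R * (j == k)%:R.
Proof. by rewrite -ptrace_12_23 -R_skew.2 ent2_flip [k == j]eq_sym. Qed.

Lemma Bmx_skewB i j : Bmx Psi i j = skewB psi i j.
Proof.
rewrite mxE ent_of_ent /=; apply: eq_bigr => a _.
have E x : [ffun=> x] = mk1 x :> mindex n 1 by [].
rewrite !E !mindex_insert1 ent_leg // restrict21 sum_mk2 (bigD1 (a, j)) //=.
rewrite override21 eqxx mulr1 big1 ?addr0 // => -[c d]; rewrite xpair_eqE /=.
by rewrite override21 mk2_eq andbC => /negPf->; rewrite mulr0.
Qed.

Lemma rs_inv i j k l :
  \sum_(v : I * I) r i j v.1 v.2 * s v.1 v.2 k l = (i == k)%:R * (j == l)%:R.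
Proof. by rewrite -ent2M mulRS ent2_1. Qed.

Lemma sr_inv i j k l :
  \sum_(v : I * I) s i j v.1 v.2 * r v.1 v.2 k l = (i == k)%:R * (j == l)%:R.
Proof. by rewrite -ent2M mulSR ent2_1. Qed.

Lemma yb_rs c b g e y z :
  \sum_(w : I * I) \sum_d r c b d w.1 * r w.1 g w.2 z * s d w.2 e y =
  \sum_(v : I * I) \sum_a s b g v.1 v.2 * r c v.1 e a * r a v.2 y z.
Proof. by rewrite -ent_12_23_12 braid_RRS ent_23_12_23. Qed.

Lemma yb_sr c b g e y z :
  \sum_(w : I * I) \sum_d s c b d w.1 * r w.1 g w.2 z * r d w.2 e y =
  \sum_(v : I * I) \sum_a r b g v.1 v.2 * r c v.1 e a * s a v.2 y z.
Proof. by rewrite -ent_12_23_12 braid_SRR ent_23_12_23. Qed.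

Lemma rE i j k l : r i j k l = s i j k l + lambda * ((i == k)%:R * (j == l)%:R).
Proof. by rewrite -ent2_1 -entZ -entD scalemx1 subrK. Qed.

Local Notation B := (skewB psi).

(** The transposed matrix of l_i^j on the fundamental module of B type. *)
Definition module_mx i j : 'M[F]_n :=
  \matrix_(a, b) (Bmx Psi a j * (i == b)%:R).
Local Notation M1 a b := (leg 1 [:: 1]%N (one_factor (module_mx a b))).
Local Notation M2 a b := (leg 1 [:: 2]%N (one_factor (module_mx a b))).

Lemma module_mxE i j a b : module_mx i j a b = B a j * (i == b)%:R.
Proof. by rewrite mxE Bmx_skewB. Qed.

Lemma one_factorM (X Y : 'M[F]_n) :
  one_factor X *m one_factor Y = one_factor (X *m Y).
Proof.
apply: ent_inj => J J'; rewrite ent_mul sum_mk1 ent_of_ent mxE.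
by apply: eq_bigr => c _; rewrite !ent_of_ent !ffunE.
Qed.

Lemma one_factorZ c (X : 'M[F]_n) : one_factor (c *: X) = c *: one_factor X.
Proof. by apply: ent_inj => J J'; rewrite entZ !ent_of_ent mxE. Qed.

(** A product of rank one matrices: the row of the first meets the column of
    the second in the scalar B_d^c. *)
Lemma module_mxM d e a c :
  one_factor (module_mx d e) *m one_factor (module_mx a c) =
  B d c *: one_factor (module_mx a e).
Proof.
rewrite one_factorM -one_factorZ; congr one_factor; apply/matrixP => u v.
rewrite mxE [RHS]mxE module_mxE;
  under eq_bigr => x _ do rewrite !module_mxE mulrAC [d == _]eq_sym.
by rewrite sum_deltar mulrCA.
Qed.

Lemma ent2_double_act a b e f u v u' v' :
  ent2 (M1 a e *m M2 b f) u v u' v' =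
    B u e * (a == u')%:R * (B v f * (b == v')%:R).
Proof.
rewrite ent2_leg1M; under eq_bigr => c _ do rewrite ent2_leg2 mulrA.
by rewrite -mulr_suml sum_deltar !module_mxE.
Qed.

Lemma fuse1_mx a b e f :
  \sum_c \sum_d r c b d f *:
    (one_factor (module_mx d e) *m one_factor (module_mx a c)) =
  (b == f)%:R *: one_factor (module_mx a e).
Proof.
rewrite -(skewB_trace skew_r) scaler_suml pair_big /=; apply: eq_bigr => p _.
by rewrite module_mxM scalerA mulrC.
Qed.

Lemma ent2_sum (T : finType) (X : T -> tmx F n 2) i j k l :
  ent2 (\sum_t X t) i j k l = \sum_t ent2 (X t) i j k l.
Proof. by rewrite /ent2 /ent summxE. Qed.

Lemma ent2Z c (X : tmx F n 2) i j k l :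
  ent2 (c *: X) i j k l = c * ent2 X i j k l.
Proof. exact: entZ. Qed.

(** In entries this is [skewB_exchange] with x = R and x' = R^-1, multiplied
    by the entries of B and of the unit matrix that the two rank one
    matrices leave outside the contraction. *)
Lemma fuse_S_mx a b e f :
  \sum_c \sum_d r c b d f *: (M1 d e *m S *m M1 a c) = M1 a e *m M2 b f.
Proof.
apply: ent2_inj => u v u' v'; rewrite ent2_double_act [B v f * _]mulrC.
rewrite -(skewB_exchange skew_l skew_r yb_rs sr_inv) ent2_sum.
rewrite -(pair_bigA _ (fun c x => B x c * \sum_d r c b d f * s d v x v')) /=
  mulr_sumr.
apply: eq_bigr => c _; rewrite ent2_sum.
rewrite [RHS]mulr_sumr; under [RHS]eq_bigr => x _ do rewrite !mulr_sumr.
rewrite [RHS]exchange_big; apply: eq_bigr => d _ /=.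
rewrite ent2Z ent2_legM1 mulr_sumr; apply: eq_bigr => x _.
rewrite ent2_leg1M module_mxE.
under eq_bigr => z _ do rewrite module_mxE mulrAC [d == _]eq_sym.
by rewrite sum_deltar; ring.
Qed.

(** The lower index a of the rank one matrix B_u^e delta_a^v runs along its
    columns, so contracting lower indices with R is multiplication on the
    right. *)
Lemma double_act_mulr i j e f :
  \sum_a \sum_b r i j a b *: (M1 a e *m M2 b f) = M1 i e *m M2 j f *m R.
Proof.
apply: ent2_inj => u v u' v'; rewrite ent2_sum ent2M.
under eq_bigr => a _ do rewrite ent2_sum.
rewrite pair_big /=.
transitivity (r i j u' v' * (B u e * B v f)).
  rewrite -(sum_delta2 (fun c d => r i j c d)) mulr_suml; apply: eq_bigr => p _.
  by rewrite ent2Z ent2_double_act; ring.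
rewrite -(sum_delta2 (fun c d => r c d u' v')) mulr_suml; apply: eq_bigr => p _.
by rewrite ent2_double_act [i == _]eq_sym [j == _]eq_sym; ring.
Qed.

(** Entry by entry the contraction gives B_1 B_2 R and the product gives R
    B_1 B_2. *)
Lemma double_act_mull i j e f :
  \sum_a \sum_b r a b e f *: (M1 i a *m M2 j b) = R *m (M1 i e *m M2 j f).
Proof.
apply: ent2_inj => u v u' v'; rewrite ent2_sum ent2M.
under eq_bigr => a _ do rewrite ent2_sum.
rewrite pair_big /=.
transitivity ((i == u')%:R * (j == v')%:R * \sum_(p : I * I) B u p.1 * B v p.2 *
  r p.1 p.2 e f).
  rewrite mulr_sumr; apply: eq_bigr => p _; rewrite ent2Z ent2_double_act; ring.
rewrite (skewB_comm skew_l skew_r rE rs_inv sr_inv yb_rs yb_sr) mulr_sumr.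
apply: eq_bigr => p _; by rewrite ent2_double_act; ring.
Qed.

Section Factors.
Variable k : nat.
Local Notation y i := (Rinv k R i).
Local Notation m a b := (leg k [:: 1]%N (one_factor (module_mx a b))).
Local Notation m' a b := (leg k [:: 2]%N (one_factor (module_mx a b))).

Lemma leg_ok_iota l i : (0 < i)%N -> (i + l <= k.+2)%N -> leg_ok k l (iota i l).
Proof.
move=> i0 ik; rewrite /leg_ok size_iota eqxx iota_uniq; apply/allP => x.
rewrite mem_iota => /andP[ix xi]; rewrite (leq_trans i0 ix) -ltnS.
exact: leq_trans xi ik.
Qed.

Lemma leg_ok_pair i : (0 < i <= k)%N -> leg_ok k 2 [:: i; i.+1].
Proof.
by move=> /andP[i0 ik]; apply: (@leg_ok_iota 2); rewrite // addn2 !ltnS.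
Qed.

Lemma RinvE i : (0 < i <= k)%N -> Rinv k R i = leg k [:: i; i.+1] S.
Proof.
move=> ik; have E := leg_mul1 (leg_ok_pair ik) mulRS.
have [U _] := mulmx1_unit E.
by rewrite /Rinv -[RHS](mulKmx U) E mulmx1.
Qed.

Lemma Rinv_braid i :
  (0 < i < k)%N -> y i *m y i.+1 *m y i = y i.+1 *m y i *m y i.+1.
Proof.
case/andP=> i0 ik; rewrite !RinvE ?i0 ?(ltnW ik) //.
have ok3 : leg_ok k 3 [:: i; i.+1; i.+2].
  by apply: (@leg_ok_iota 3); rewrite // addn3 !ltnS.
have E12 : leg k [:: i; i.+1; i.+2] S12 =
  leg k [:: i; i.+1] S by rewrite leg_leg.
have E23 : leg k [:: i; i.+1; i.+2] S23 =
  leg k [:: i.+1; i.+2] S by rewrite leg_leg.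
by rewrite -E12 -E23 -!legM // braid_SSS.
Qed.

Lemma Rinv_far i j : (0 < i)%N -> (i.+1 < j <= k)%N -> y i *m y j = y j *m y i.
Proof.
move=> i0 /andP[ij jk].
have ik : (0 < i <= k)%N by rewrite i0 ltnW // (leq_trans _ jk) // ltnW.
have j0 : (0 < j <= k)%N by rewrite jk (leq_ltn_trans _ ij).
rewrite !RinvE // leg_comm ?leg_ok_pair //=.
rewrite !inE; lia.
Qed.

Lemma Rinv_quad i : (0 < i <= k)%N -> y i *m y i = 1%:M - lambda *: y i.
Proof.
by move=> ik; rewrite RinvE // -legM ?leg_ok_pair // mulSS legB ?legZ ?leg1
  ?leg_ok_pair.
Qed.

Lemma m_Rinv i a b : (1 < i <= k)%N -> m a b *m y i = y i *m m a b.
Proof.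
case/andP=> i1 ik;
  rewrite RinvE ?(ltnW i1) // leg_comm // ?leg_ok_pair ?(ltnW i1) //=.
rewrite !inE; lia.
Qed.

Lemma fuse1_leg a b e f :
  \sum_c \sum_d r c b d f *: (m d e *m m a c) = (b == f)%:R *: m a e.
Proof.
rewrite -legZ // -fuse1_mx leg_sum //; apply: eq_bigr => c _.
by rewrite leg_sum //; apply: eq_bigr => d _; rewrite legZ // legM.
Qed.

Hypothesis k_gt0 : (0 < k)%N.

Let ok12 : leg_ok k 2 [:: 1; 2]%N. Proof. exact: leg_ok_pair. Qed.
(* Factors 1 and 2 as legs inside the pair of legs 1, 2, so that identities
    of matrices on two factors can be carried over. *)
Let leg1E (X : tmx F n 1) :
  leg k [:: 1]%N X = leg k [:: 1; 2]%N (leg 1 [:: 1]%N X) :> tmx F n k.+1.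
Proof. by rewrite leg_leg. Qed.
Let leg2E (X : tmx F n 1) :
  leg k [:: 2]%N X = leg k [:: 1; 2]%N (leg 1 [:: 2]%N X) :> tmx F n k.+1.
Proof. by rewrite leg_leg. Qed.

Lemma fuse_Rinv a b e f :
  \sum_c \sum_d r c b d f *: (m d e *m y 1 *m m a c) = m a e *m m' b f.
Proof.
rewrite RinvE ?leg1E ?leg2E // -legM // -fuse_S_mx leg_sum //;
  apply: eq_bigr => c _.
rewrite leg_sum //; apply: eq_bigr => d _.
by rewrite legZ // !legM // !leg1E.
Qed.

Lemma Rinv_lambda : y 1 + lambda%:M = leg k [:: 1; 2]%N R.
Proof.
rewrite RinvE // -scalemx1 -(leg1 _ ok12) -legZ // -legD //; congr leg.
by rewrite scalemx1 subrK.
Qed.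

Lemma double_act_mulr_leg i j e f :
  \sum_a \sum_b r i j a b *: (m a e *m m' b f) =
  m i e *m m' j f *m (y 1 + lambda%:M).
Proof.
rewrite Rinv_lambda !leg1E !leg2E -!legM // -double_act_mulr leg_sum //;
  apply: eq_bigr => a _.
rewrite leg_sum //; apply: eq_bigr => b _.
by rewrite leg1E leg2E legZ // legM.
Qed.

Lemma double_act_mull_leg i j e f :
  \sum_a \sum_b r a b e f *: (m i a *m m' j b) =
  (y 1 + lambda%:M) *m (m i e *m m' j f).
Proof.
rewrite Rinv_lambda !leg1E !leg2E -!legM // -double_act_mull leg_sum //;
  apply: eq_bigr => a _.
rewrite leg_sum //; apply: eq_bigr => b _.
by rewrite leg1E leg2E legZ // legM.
Qed.
End Factors.

End Hecke.

(** * Entries of the reflection equation *)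

Section ReflectionEntries.
Variables (F : fieldType) (n : nat) (R : tmx F n 2).
Local Notation r := (ent2 R).

Lemma reflection_eqE (A : algType F) (L : 'M[A]_n) i j e f :
  ent2 (reflection_eq R L) i j e f =
  \sum_a \sum_b \sum_c \sum_d (r i j a b * r c b d f) *: (L a c * L d e)
  - \sum_a \sum_b \sum_c \sum_d (r a j b c * r d c e f) *: (L i a * L b d)
  - (\sum_a r i j a f *: L a e - \sum_d r d j e f *: L i d).
Proof.
have entR a b c d : ent2 (map_mx (in_alg A) R) a b c d = (r a b c d)%:A.
  by rewrite /ent2 /ent mxE.
rewrite /reflection_eq; set R' := map_mx _ R; set L1 := leg _ _ _.
rewrite /ent2 !entB -!/(ent2 _ _ _ _ _); congr (_ - _ - (_ - _)).
- rewrite ent2_legM1; transitivity (\sum_d \sum_(p : 'I_n * 'I_n) \sum_a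
      (r i j a p.2 * r p.1 p.2 d f) *: (L a p.1 * L d e)).
    apply: eq_bigr => d _; rewrite ent2M mulr_suml; apply: eq_bigr => p _.
    rewrite ent2_legM1 !mulr_suml; apply: eq_bigr => a _.
    by rewrite !entR !mulr_algl mulr_algr -!scalerAl scalerA mulrC.
  rewrite exchange_big /=; under eq_bigr => p _ do rewrite exchange_big.
  rewrite exchange_big; apply: eq_bigr => a _ /=.
  by rewrite [RHS]exchange_big [RHS]pair_big.
- rewrite -!mulmxA ent2_leg1M; apply: eq_bigr => a _.
  rewrite ent2M mulr_sumr.
  rewrite -(pair_bigA _
    (fun b c => L i a * (ent2 R' a j b c * ent2 (L1 *m R') b c e f))) /=.
  apply: eq_bigr => b _; apply: eq_bigr => c _; rewrite ent2_leg1M !mulr_sumr.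
  apply: eq_bigr => d _; rewrite !entR mulr_algl mulr_algr -!scalerAr.
  by rewrite scalerA.
- by rewrite ent2_legM1; apply: eq_bigr => a _; rewrite entR mulr_algl.
by rewrite ent2_leg1M; apply: eq_bigr => d _; rewrite entR mulr_algr.
Qed.

Section Antimorphism.
Variables (A S : algType F) (g : A -> S) (T : 'I_n -> 'I_n -> A).
Hypotheses (g_linear : linear g) (gM : forall x y, g (x * y) = g y * g x).

HB.instance Definition _ := GRing.isLinear.Build F A S _ g g_linear.

Lemma reflection_eq_antimorphism :
  (forall i j e f,
    \sum_a \sum_b \sum_c \sum_d (r i j a b * r c b d f) *: (T d e * T a c)
    - \sum_a \sum_b \sum_c \sum_d (r a j b c * r d c e f) *: (T b d * T i a)
    = \sum_a r i j a f *: T a e - \sum_d r d j e f *: T i d) ->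
  reflection_eq R (\matrix_(i, j) g (T i j)) = 0.
Proof.
move=> T_refl; apply: ent2_inj => i j e f.
rewrite reflection_eqE [RHS]mxE; apply/eqP; rewrite subr_eq0; apply/eqP.
transitivity (g (\sum_a r i j a f *: T a e - \sum_d r d j e f *: T i d)).
  rewrite -T_refl linearB /=; congr (_ - _);
    rewrite linear_sum; apply: eq_bigr => a _ /=;
    rewrite linear_sum; apply: eq_bigr => b _ /=;
    rewrite linear_sum; apply: eq_bigr => c _ /=;
    rewrite linear_sum; apply: eq_bigr => d _ /=;
    by rewrite linearZ /= gM !mxE.
rewrite linearB /=; congr (_ - _); rewrite linear_sum; apply: eq_bigr => a _ /=;
  by rewrite linearZ mxE.
Qed.
End Antimorphism.

Lemma map_reflection_eq (A A' : lalgType F) (f : {rmorphism A -> A'})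
  (L : 'M[A]_n) :
  (forall c, f c%:A = c%:A) ->
  map_mx f (reflection_eq R L) = reflection_eq R (map_mx f L).
Proof.
move=> fA; rewrite /reflection_eq !(map_mxB, map_mxM) /=.
have -> : map_mx f (map_mx (in_alg A) R) = map_mx (in_alg A') R.
  by apply/matrixP => a b; rewrite !mxE /= fA.
have -> // : map_mx f (leg 1 [:: 1]%N (one_factor L)) =
   leg 1 [:: 1]%N (one_factor (map_mx f L)).
apply/matrixP => a b; rewrite !mxE /=; case: ifP => _; last exact: rmorph0.
by rewrite /ent !mxE.
Qed.
End ReflectionEntries.

(** * The universal property of the reflection equation algebra *)

(** A matrix over A satisfying the reflection equation defines a morphism on
    the free algebra by evaluating words; it kills the defining ideal, so it
    descends. *)
Section Universal.
Local Open Scope quotient_scope.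
Variables (F : fieldType) (n : nat) (R : tmx F n 2) (A : algType F)
  (L : 'M[A]_n).
Hypothesis L_refl : reflection_eq R L = 0.

Let word (w : {fmonom ('I_n * 'I_n)%type}) : A := \prod_(x <- w) L x.1 x.2.

Let word_mmorphism : mmorphism word.
Proof.
by split=> [v w|]; rewrite /word ?fmM ?big_cat ?fm1 ?big_nil.
Qed.

HB.instance Definition _ := isMultiplicative.Build _ _ word word_mmorphism.

Let ev (x : free_alg F n) : A := mmap (in_alg A) word x.

Lemma ev_linear : linear ev.
Proof. by move=> c x y; rewrite /ev mmapD mmapZ mulr_algl. Qed.

Lemma ev_multiplicative : multiplicative ev.
Proof.
by apply: commr_mmap_is_multiplicative => x m m';
  rewrite /GRing.comm mulr_algl mulr_algr.
Qed.

HB.instance Definition _ := GRing.isLinear.Build F _ _ _ ev ev_linear.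
HB.instance Definition _ :=
  GRing.isMultiplicative.Build _ _ ev ev_multiplicative.

Lemma ev_gen i j : ev (free_gen F n i j) = L i j.
Proof.
by rewrite mxE /ev mmapU /= scale1r mul1r /word fmU big_seq1.
Qed.

Lemma ev_ideal x : ideal_gen (mrea_rel R) x -> ev x = 0.
Proof.
apply: (ideal_gen_rmorph0 (f := ev)) => y [I [J ->]].
transitivity (ent (map_mx ev (reflection_eq R (free_gen F n))) I J).
  by rewrite /ent [RHS]mxE.
rewrite map_reflection_eq; last by move=> c /=; rewrite linearZ /= rmorph1.
have -> : map_mx ev (free_gen F n) =
  L by apply/matrixP => i j; rewrite mxE ev_gen.
by rewrite L_refl /ent mxE.
Qed.

Let pi x : mrea R := \pi_(mrea R) x.

Lemma ev_repr x : ev (repr (pi x)) = ev x.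
Proof.
apply/eqP; rewrite -subr_eq0 -raddfB; apply/eqP/ev_ideal/mrea_idealP.
have -> : (repr (pi x) - x \in mrea_ideal R) = (repr (pi x) == x %[mod mrea R]).
  by rewrite piE.
by rewrite reprK.
Qed.

Lemma mrea_lift : exists phi : mrea R -> A,
  [/\ linear phi, phi 1 = 1, (forall x y, phi (x * y) = phi x * phi y)
    & forall i j, phi (mrea_gen R i j) = L i j].
Proof.
exists (fun x => ev (repr x)); split=> [c x y||x y|i j].
- have -> : c *: x + y = pi (c *: repr x + repr y).
    rewrite -[y in LHS]reprK -[c *: x]/(pi (c *: repr x)).
    by rewrite /pi !piE.
  by rewrite ev_repr linearP.
- by rewrite -[1]/(pi 1) ev_repr rmorph1.
- by rewrite -[x * y]/(pi (repr x * repr y)) ev_repr rmorphM.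
by rewrite ev_repr ev_gen.
Qed.
End Universal.

(** * Matrices acting on row vectors *)

Section RowAction.
Variables (F : fieldType) (T : finType).
Local Notation V := (coord_space F T).
Implicit Types X Y : 'M[F]_#|T|.

(** The endomorphism whose transposed matrix is X: coordinate vectors are
    rows and X acts on them from the right, hence the reversal in
    [row_lfunM]. *)
Definition row_fun X (v : V) : V := [ffun J => \sum_I v I * ent X I J].

Lemma row_fun_linear X : linear (row_fun X).
Proof.
move=> c u v; apply/ffunP => J;
  rewrite [in RHS]ffunE !ffunE -[RHS]/(c * _ + _) mulr_sumr -big_split.
by apply: eq_bigr => I _; rewrite !ffunE -[c *: u I]/(c * u I) mulrDl mulrA.
Qed.

HB.instance Definition _ X :=
  GRing.isLinear.Build F V V _ (row_fun X) (row_fun_linear X).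

Definition row_lfun X : 'End(V) := linfun (row_fun X).

Lemma row_lfunE X v J : row_lfun X v J = \sum_I v I * ent X I J.
Proof. by rewrite lfunE ffunE. Qed.

Lemma tr_ent_row X I J : tr_ent (row_lfun X) I J = ent X I J.
Proof.
rewrite /tr_ent row_lfunE; under eq_bigr => K _ do rewrite ffunE eq_sym.
by rewrite sum_deltal.
Qed.

Lemma row_lfun1 : row_lfun 1%:M = \1%VF.
Proof.
apply/lfunP => v; apply/ffunP => J; rewrite row_lfunE lfunE.
by under eq_bigr => K _ do rewrite ent1; rewrite sum_deltar.
Qed.

Lemma row_lfunM X Y : row_lfun (X *m Y) = (row_lfun Y \o row_lfun X)%VF.
Proof.
apply/lfunP => v; apply/ffunP => J; rewrite comp_lfunE !row_lfunE.
under eq_bigr => K _ do rewrite ent_mul mulr_sumr.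
rewrite exchange_big; apply: eq_bigr => K _ /=; rewrite row_lfunE mulr_suml.
by apply: eq_bigr => I _; rewrite mulrA.
Qed.

Lemma row_lfun_is_linear : linear row_lfun.
Proof.
move=> c X Y; apply/lfunP => v; apply/ffunP => J.
rewrite row_lfunE add_lfunE scale_lfunE [RHS]ffunE [X in _ = X + _]ffunE
  !row_lfunE.
rewrite -[RHS]/(c * _ + _) mulr_sumr -big_split; apply: eq_bigr => I _.
by rewrite entD entZ mulrDr; congr (_ + _); rewrite mulrCA.
Qed.

HB.instance Definition _ :=
  GRing.isLinear.Build F _ _ _ row_lfun row_lfun_is_linear.
End RowAction.

(** * Tensor powers of the fundamental module *)

Section EndAlgebra.
Variables (F : fieldType) (V : vectType F) (V_proper : (0 < dim V)%N).

(** Endomorphisms with composition as product. The converse of this algebra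
    is [lfun_algType], in which transposed matrices multiply in the usual
    order. *)
Definition comp_lalg : lalgType F := HB.pack 'End(V)
  (lfun_comp_nzRingType V_proper)
  (GRing.Lmodule_isLalgebra.Build F (lfun_comp_nzRingType V_proper)
     (fun k x y => comp_lfunZl k x y)).

Definition comp_alg : algType F := HB.pack 'End(V) comp_lalg
  (GRing.Lalgebra_isAlgebra.Build F comp_lalg (fun k x y => comp_lfunZr k x y)).
End EndAlgebra.

Lemma dim_coord_space (F : fieldType) (T : finType) : (0 < #|T|)%N ->
  (0 < dim (coord_space F T))%N.
Proof. by move=> T_gt0; rewrite -[dim _]/(#|T| * 1)%N muln1. Qed.

(** The matrix identities of the previous parts are moved along [row_lfun]
    into the algebra A, where [tensor_act_reflection] applies. *)
Section Tensor.
Variables (F : fieldType) (n : nat) (q : F) (R Psi : tmx F n 2).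
Hypotheses (q_neq0 : q != 0) (R_braid : yang_baxter R) (R_hecke : hecke q R).
Hypothesis R_skew : skew_inverse R Psi.
Variable k : nat.
Hypothesis n_gt0 : (0 < n)%N.
Local Notation T := (mindex n k.+1).

Lemma mindex_gt0 : (0 < #|{: T}|)%N.
Proof. by rewrite card_ffun !card_ord expn_gt0 n_gt0. Qed.

Let proper := dim_coord_space F mindex_gt0.
Let A : algType F := lfun_algType proper.
Let y (i : nat) : A := row_lfun (Rinv k R i).
Let m (a b : 'I_n) :
  A := row_lfun (leg k [:: 1]%N (one_factor (module_mx Psi a b))).
Let G (a b e f : 'I_n) :
  A := row_lfun (leg k [:: 1]%N (one_factor (module_mx Psi a e))
  *m leg k [:: 2]%N (one_factor (module_mx Psi b f))).

Let rowM (X Y : tmx F n k.+1) :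
  row_lfun (X *m Y) = (row_lfun X : A) * row_lfun Y.
Proof. exact: row_lfunM. Qed.
Let row1 : row_lfun (1%:M : tmx F n k.+1) = 1 :> A.
Proof. exact: row_lfun1. Qed.

Let y_braid i : (0 < i < k)%N -> y i * y i.+1 * y i = y i.+1 * y i * y i.+1.
Proof. by move=> ik; rewrite -!rowM (Rinv_braid q_neq0). Qed.

Let y_far i j : (0 < i)%N -> (i.+1 < j <= k)%N -> y i * y j = y j * y i.
Proof. by move=> i0 ij; rewrite -!rowM (Rinv_far q_neq0). Qed.

Let y_quad i : (0 < i <= k)%N -> y i * y i = 1 - lambda q *: y i.
Proof.
by move=> ik; rewrite -rowM (Rinv_quad q_neq0) // linearB linearZ /= row1.
Qed.

Let m_y i a b : (1 < i <= k)%N -> GRing.comm (m a b) (y i).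
Proof. by move=> ik; rewrite /GRing.comm -!rowM (m_Rinv Psi q_neq0). Qed.

Let fuse1 a b e f : fuse (ent2 R) m 1 a b e f = (b == f)%:R *: m a e.
Proof.
rewrite /m -linearZ -(fuse1_leg R_skew) /fuse linear_sum /=;
  apply: eq_bigr => c _.
by rewrite linear_sum /=; apply: eq_bigr => d _; rewrite linearZ /= rowM mulr1.
Qed.

Let fuse_y :
  (0 < k)%N -> forall a b e f, fuse (ent2 R) m (y 1) a b e f = G a b e f.
Proof.
move=> k0 a b e f;
  rewrite /G -(fuse_Rinv q_neq0 R_braid R_hecke R_skew) // /fuse linear_sum /=.
apply: eq_bigr => c _; rewrite linear_sum /=; apply: eq_bigr => d _.
by rewrite linearZ /= !rowM.
Qed.

Let y_lambda : y 1 + (lambda q)%:A = row_lfun (Rinv k R 1 + (lambda q)%:M).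
Proof. by rewrite linearD -scalemx1 linearZ /= row1. Qed.

Let rG : (0 < k)%N -> forall i j e f,
  \sum_a \sum_b ent2 R i j a b *: G a b e f = G i j e f * (y 1 + (lambda q)%:A).
Proof.
move=> k0 i j e f;
  rewrite y_lambda -rowM -(double_act_mulr_leg Psi q_neq0) // linear_sum /=.
by apply: eq_bigr => a _; rewrite linear_sum /=; apply: eq_bigr => b _;
  rewrite linearZ.
Qed.

Let Gr : (0 < k)%N -> forall i j e f,
  \sum_a \sum_b ent2 R a b e f *: G i j a b = (y 1 + (lambda q)%:A) * G i j e f.
Proof.
move=> k0 i j e f;
  rewrite y_lambda -rowM -(double_act_mull_leg q_neq0 R_braid) // linear_sum /=.
by apply: eq_bigr => a _; rewrite linear_sum /=; apply: eq_bigr => b _;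
  rewrite linearZ.
Qed.

(** The product of [comp_alg] is the one of A reversed, which turns
    [tensor_act_reflection] into the reflection equation in its original
    order. *)
Lemma tensor_reflection :
  reflection_eq R (\matrix_(i, j) tensor_act k y m i j : 'M[comp_alg proper]_n)
    = 0.
Proof.
apply: (reflection_eq_antimorphism (A := A) (S := comp_alg proper) (g := id)) =>
  //.
exact: tensor_act_reflection y_braid y_far y_quad m_y fuse1 fuse_y rG Gr.
Qed.

(** The term s = 0 of [tensor_act] is M; the others are the chains of
    inverses. *)
Lemma tensor_actE i j : tensor_act k y m i j = row_lfun (
  let M := leg k [:: 1]%N (one_factor (module_mx Psi i j)) in
  M + \sum_(1 <= s < k.+1) Rinv_chain k R s 1 *m M *m Rinv_chain k R 1 s).
Proof.
have row_prod (l : seq nat) : row_lfun (\prod_(x <- l) Rinv k R x) =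
  \prod_(x <- l) y x.
  exact: (big_morph (fun X => row_lfun X : A) rowM row1).
rewrite /tensor_act big_ltn // mul1r mulr1 linearD linear_sum /=; congr (_ + _).
apply: eq_big_nat => s /andP[s0 _]; rewrite !rowM.
have -> : dchain y 0 s = row_lfun (Rinv_chain k R s 1).
  rewrite dchain_rev -row_prod /Rinv_chain add0n; case: leqP => // s1.
  have -> : s = 1%N by apply/eqP; rewrite eqn_leq s1.
  by congr row_lfun; rewrite /index_iota /= !big_seq1.
have -> // : uchain y 0 s = row_lfun (Rinv_chain k R 1 s).
by rewrite uchain_iota -row_prod /Rinv_chain add0n s0.
Qed.

Theorem tensor_module : exists rho : mrea R -> 'End(coord_space F T),
    is_representation rho /\
    forall i j, of_ent (tr_ent (rho (mrea_gen R i j))) =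
      let M := leg k [:: 1]%N (one_factor (module_mx Psi i j)) in
      M + \sum_(1 <= s < k.+1) Rinv_chain k R s 1 *m M *m Rinv_chain k R 1 s.
Proof.
have [rho [lin rho1 rhoM rhoE]] := mrea_lift tensor_reflection.
exists rho; split=> [|i j]; first by split.
rewrite rhoE mxE tensor_actE.
by apply: ent_inj => I J; rewrite ent_of_ent tr_ent_row.
Qed.
End Tensor.

Theorem proposition2 (K : realType) (n : nat) (q : K[i]) (p : nat)
    (R Psi : tmx K[i] n 2) (pi : mrea R -> 'End(coord_space K[i] 'I_n))
    (n_ge1 : (1 <= n)%N)
    (q_neq0 : q != 0)
    (q_generic : forall m : nat, (1 <= m)%N -> q ^+ m != 1)
    (R_braid : yang_baxter R)
    (R_hecke : hecke q R)
    (R_skew : skew_inverse R Psi)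
    (R_rank : symmetry_rank q R p)
    (pi_fund : fundamental_B Psi pi)
    (k : nat) :
  exists rho : mrea R -> 'End(coord_space K[i] (mindex n k.+1)),
    is_representation rho /\
    forall i j : 'I_n,
      let pi_t := leg k [:: 1]%N
        (one_factor (\matrix_(a, b) tr_ent (pi (mrea_gen R i j)) a b)) in
      of_ent (tr_ent (rho (mrea_gen R i j))) =
        pi_t + \sum_(1 <= s < k.+1)
                 Rinv_chain k R s 1 *m pi_t *m Rinv_chain k R 1 s.
Proof.
have [rho [rhoP rhoE]] := tensor_module q_neq0 R_braid R_hecke R_skew k n_ge1.
exists rho; split=> [|i j]; first exact: rhoP.
suff -> : \matrix_(a, b) tr_ent (pi (mrea_gen R i j)) a b = module_mx Psi i j.
  exact: rhoE.
apply/matrixP => a b; rewrite mxE [RHS]mxE /tr_ent pi_fund.2 !ffunE.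
by [].
Qed.
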